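(* The problem \textsc{bMVA} admits a kernel with $O(k^2 m)$ bits. That is, there is a polynomial-time algorithm which, given any instance $\mathcal{I}[m,n,p,k]$ of \textsc{bMVA}, outputs an equivalent instance of \textsc{bMVA} (one is a yes-instance if and only if the other is) whose encoding has size $O(k^2 m)$ bits.
   Context: Multidimensional Binary Vector Assignment (\textsc{bMVA}). An instance $\mathcal{I}[m,n,p,k]$ consists of integers $m,n,p,k$, and $m$ sets (multisets) $V^1,\dots,V^m$, where each $V^i=\{v^i_1,\dots,v^i_n\}$ consists of $n$ binary vectors $v^i_j\in\{0,1\}^p$. A stack is an $m$-tuple $s=(v^s_1,\dots,v^s_m)$ with $v^s_i\in V^i$ for all $i\in[m]$, where $[m]=\{1,\dots,m\}$; its associated vector is $v_s=\bigwedge_{i\in[m]}v^s_i$ (component-wise AND). A solution is a set $S=\{s_1,\dots,s_n\}$ of $n$ pairwise disjoint stacks, i.e. each vector $v^i_j$ belongs to exactly one stack. The cost of a vector $v\in\{0,1\}^p$ is its number of zeros, $c(v)=p-\sum_{r=1}^p v[r]$, and $c(S)=\sum_{j=1}^n c(v_{s_j})$. The question is whether there is a solution $S$ with $c(S)\le k$. *)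

(* Defs.v *)
From mathcomp Require Import all_boot.

Set Implicit Arguments.
Unset Strict Implicit.
Unset Printing Implicit Defensive.

(* The sets V^i are multisets, hence families: [vec I i j] is v^i_j.          *)
Record instance := Instance {
  dim_m : nat;
  dim_n : nat;
  dim_p : nat;
  budget : nat;
  vec : 'I_dim_m -> 'I_dim_n -> dim_p.-tuple bool
}.

Section Problem.

Variable I : instance.

(* [s i] is the index in V^i of the vector chosen by the stack, so that equal *)
(* vectors of the multiset V^i remain distinguishable.                        *)
Definition stack := {ffun 'I_(dim_m I) -> 'I_(dim_n I)}.

Definition stack_vector (s : stack) : (dim_p I).-tuple bool :=
  [tuple \big[andb/true]_(i < dim_m I) tnth (vec i (s i)) r | r < dim_p I].

Definition disjoint_stacks (s t : stack) : Prop := forall i, s i <> t i.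

(* n pairwise disjoint stacks use n distinct vectors of each V^i, i.e. each   *)
(* v^i_j belongs to exactly one of them.                                      *)
Definition is_solution (S : 'I_(dim_n I) -> stack) : Prop :=
  forall a b, a <> b -> disjoint_stacks (S a) (S b).

Definition vector_cost (p : nat) (v : p.-tuple bool) : nat :=
  p - \sum_(r < p) nat_of_bool (tnth v r).

Definition solution_cost (S : 'I_(dim_n I) -> stack) : nat :=
  \sum_(j < dim_n I) vector_cost (stack_vector (S j)).

Definition bMVA : Prop :=
  exists S : 'I_(dim_n I) -> stack,
    is_solution S /\ solution_cost S <= budget I.

End Problem.

(* Binary digits, least significant first; [up_log 2 n.+1] is the bit length  *)
(* of n (0 for n = 0).                                                        *)
Definition binary (n : nat) : seq bool :=
  mkseq (fun i => odd (n %/ 2 ^ i)) (up_log 2 n.+1).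

(* Self-delimiting: every digit is preceded by 1 and a final 0 ends the code. *)
Definition encode_nat (n : nat) : seq bool :=
  flatten [seq [:: true; b] | b <- binary n] ++ [:: false].

(* A header of O(log m + log n + log p + log k) bits, then the m * n * p      *)
(* entries of the vectors.                                                    *)
Definition encode (I : instance) : seq bool :=
  encode_nat (dim_m I) ++ encode_nat (dim_n I) ++
  encode_nat (dim_p I) ++ encode_nat (budget I) ++
  flatten [seq flatten [seq tval (vec i j) | j <- enum 'I_(dim_n I)]
          | i <- enum 'I_(dim_m I)].

(* Deterministic multitape Turing machines. Cells hold [None] (blank), a bit, *)
(* or an auxiliary symbol of the machine. A tape (l, r) is infinite in both   *)
(* directions, all cells not listed being blank: r lists the cells from the   *)
(* head rightwards, l the cells on the left of the head, nearest first.       *)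
Inductive direction := Left | Stay | Right.

Definition symbol (X : Type) : Type := option (bool + X).

Definition tape (X : Type) : Type := (seq (symbol X) * seq (symbol X))%type.

Definition tape_read (X : Type) (t : tape X) : symbol X := head None t.2.

Definition tape_write (X : Type) (a : symbol X) (t : tape X) : tape X :=
  (t.1, a :: behead t.2).

Definition tape_move (X : Type) (d : direction) (t : tape X) : tape X :=
  match d with
  | Left => (behead t.1, head None t.1 :: t.2)
  | Stay => t
  | Right => (head None t.2 :: t.1, behead t.2)
  end.

(* The number of tapes is [tm_extra.+1]; the transition function maps the     *)
(* state and the scanned symbols to the new state and, for every tape, the    *)
(* symbol to write and the direction of the move.                             *)
Record turing_machine := TuringMachine {
  tm_state : finType;
  tm_aux : finType;
  tm_extra : nat;
  tm_start : tm_state;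
  tm_halt : pred tm_state;
  tm_trans : tm_state -> {ffun 'I_tm_extra.+1 -> symbol tm_aux} ->
    tm_state * {ffun 'I_tm_extra.+1 -> symbol tm_aux * direction}
}.

Section Run.

Variable M : turing_machine.

Definition config : Type :=
  (tm_state M * {ffun 'I_(tm_extra M).+1 -> tape (tm_aux M)})%type.

Definition word_tape (w : seq bool) : tape (tm_aux M) :=
  ([::], [seq Some (inl b) | b <- w]).

Definition initial (w : seq bool) : config :=
  (tm_start M, [ffun i => if i == ord0 then word_tape w else ([::], [::])]).

Definition step (c : config) : config :=
  if tm_halt c.1 then c else
  let a := tm_trans c.1 [ffun i => tape_read (c.2 i)] in
  (a.1, [ffun i => tape_move (a.2 i).2 (tape_write (a.2 i).1 (c.2 i))]).

Fixpoint leading_bits (s : seq (symbol (tm_aux M))) : seq bool :=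
  if s is Some (inl b) :: s' then b :: leading_bits s' else [::].

(* The word written on the first tape from the head rightwards, up to the     *)
(* first cell that does not hold a bit.                                       *)
Definition output (c : config) : seq bool := leading_bits (c.2 ord0).2.

Definition outputs_within (t : nat) (w w' : seq bool) : Prop :=
  let c := iter t step (initial w) in tm_halt c.1 /\ output c = w'.

End Run.

Definition polynomial_time (f : instance -> instance) : Prop :=
  exists (M : turing_machine) (a d : nat), forall I : instance,
    outputs_within M (a * size (encode I) ^ d + a) (encode I) (encode (f I)).

(* Main.v *)
(* Kernel. A solution of cost at most k has at least n - k stacks of cost 0,   *)
(* and these consist of all-ones vectors. Hence each V^i has n - k of them (or *)
(* the answer is no), and they can be dropped from each V^i: since they are    *)
(* equal to each other, the free stacks may be assumed to use them. Likewise a *)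
(* coordinate where some vector has a zero costs at least 1, so at least p - k *)
(* coordinates are constantly 1 and that many can be dropped. This leaves      *)
(* min(n,k) vectors of min(p,k) coordinates in each set, so the numbers of the *)
(* new header are copies of numbers of the old one.                            *)
(*                                                                             *)
(* Polynomial time. The tapes of a Turing machine are used as stacks of bits,  *)
(* with the top under the head. Structured programs over these stacks compile  *)
(* to Turing machines, the control states of a program being defined by        *)
(* recursion on it, and the kernel is computed by such a program.              *)

(* In a solution of cost at most k, every stack of positive cost pays at least 1, so at least n - k
   stacks are free and consist of all-ones vectors. Hence every V^i holds n - k all-ones vectors
   ([assignable_ones]). Dropping that many from each V^i preserves the answer: stacks made of them
   alone can be added at no cost, and conversely n - k free stacks can be removed from a solution
   ([assignable_rows]). If vectors or coordinates to drop are missing ([deficit]), the answer is no.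
   Otherwise m * min(n,k) * min(p,k) bits of data remain. Instances without data, or with budget 0
   and no deficit, are yes-instances and get a constant kernel; in the remaining case m and k are at
   most k^2 * m, which absorbs the header ([size_kernel]).

   These arguments are about [assignable], where a solution is a rearrangement of each list of
   vectors; [bMVA_assignable] relates it to stacks.

   For the running time, [runs] gives timed triples for stack programs and [runs_outputs] carries
   them over to Turing machines. The vectors and coordinates to drop are chosen greedily, so one
   pass over the data finds the flags and a second one writes the kernel. [run_program] bounds the
   time by a quadratic polynomial, and [kernel_polynomial] identifies the word computed with the
   code of [kernel]. *)
Require Import Defs.
From mathcomp Require Import all_boot.
From mathcomp Require Import zify.

Set Implicit Arguments.
Unset Strict Implicit.
Unset Printing Implicit Defensive.

(** * Stack programs and their compilation *)

(* [Case i f] pops a bit from stack i ([None] if it is empty) and runs f on   *)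
(* it; [Loop i f] pops bits from stack i and runs f on them until it is empty. *)
Inductive cmd :=
| Skip
| Push of nat & bool
| Seq of cmd & cmd
| Case of nat & (option bool -> cmd)
| Loop of nat & (bool -> cmd).

Definition state := nat -> seq bool.

Definition upd (s : state) (i : nat) (w : seq bool) : state :=
  fun j => if eqn j i then w else s j.

Section Compilation.

Variable K : nat.

Definition tapes := {ffun 'I_K.+1 -> tape void}.
Definition actions := 'I_K.+1 -> symbol void * direction.

(** In [Case] and [Loop], [None] is the state about to pop; a tagged state lies in the branch of the
    value popped, so the control remembers that value. [Push] has two states because the head has to
    move left before it writes. *)
Fixpoint ctrl (c : cmd) : finType :=
  match c with
  | Skip => unit
  | Push _ _ => bool
  | Seq c1 c2 => (ctrl c1 + ctrl c2)%type
  | Case _ f => option {o : option bool & ctrl (f o)}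
  | Loop _ f => option {b : bool & ctrl (f b)}
  end.

Fixpoint entry (c : cmd) : ctrl c :=
  match c with
  | Skip => tt
  | Push _ _ => false
  | Seq c1 c2 => inl (entry c1)
  | Case _ f => None
  | Loop _ f => None
  end.

Definition bit_of (x : symbol void) : option bool :=
  if x is Some (inl b) then Some b else None.

Definition act_on (i : nat) (x : symbol void * direction)
    (a : {ffun 'I_K.+1 -> symbol void}) : actions :=
  fun j => if val j == i then x else (a j, Stay).

Definition keep (a : {ffun 'I_K.+1 -> symbol void}) : actions :=
  fun j => (a j, Stay).

(** A next state [None] means that the command is over; the enclosing command redirects this exit to
    its own continuation, which for a loop body is the test of the loop. *)
Fixpoint delta (c : cmd) (a : {ffun 'I_K.+1 -> symbol void}) {struct c} :
    ctrl c -> option (ctrl c) * actions :=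
  match c return ctrl c -> option (ctrl c) * actions with
  | Skip => fun _ => (None, keep a)
  | Push i b => fun q : bool =>
      if q then (None, act_on i (Some (inl b), Stay) a)
      else (Some true, act_on i (a (inord i), Left) a)
  | Seq c1 c2 => fun q =>
      match q with
      | inl q1 => let: (o, x) := delta a q1 in
                  (Some (if o is Some q' then inl q' else inr (entry c2)), x)
      | inr q2 => let: (o, x) := delta a q2 in (omap inr o, x)
      end
  | Case i f => fun q =>
      match q with
      | None => let o := bit_of (a (inord i)) in
          (Some (Some (Tagged (fun o => ctrl (f o)) (entry (f o)))),
           act_on i (None, Right) a)
      | Some (existT o q') => let: (r, x) := delta a q' in
          (omap (fun q1 => Some (Tagged (fun o => ctrl (f o)) q1)) r, x)
      end
  | Loop i f => fun q =>
      match q with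
      | None =>
          (omap (fun b => Some (Tagged (fun b => ctrl (f b)) (entry (f b))))
                (bit_of (a (inord i))),
           act_on i (None, Right) a)
      | Some (existT b q') => let: (r, x) := delta a q' in
          (Some (omap (fun q1 => Tagged (fun b => ctrl (f b)) q1) r), x)
      end
  end.

Definition reads (T : tapes) : {ffun 'I_K.+1 -> symbol void} :=
  [ffun i => tape_read (T i)].

Definition acted (x : actions) (T : tapes) : tapes :=
  [ffun i => tape_move (x i).2 (tape_write (x i).1 (T i))].

Inductive reach (c : cmd) : nat -> ctrl c -> tapes -> tapes -> Prop :=
| reach_last q T x : delta (reads T) q = (None, x) -> reach 1 q T (acted x T)
| reach_step n q q' T x T' : delta (reads T) q = (Some q', x) ->
    reach n q' (acted x T) T' -> reach n.+1 q T T'.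

Lemma reach_seq_r c1 c2 n (q : ctrl c2) T T' :
  reach n q T T' -> @reach (Seq c1 c2) n (inr q) T T'.
Proof.
elim=> [{}q {}T x Dq|{}n {}q q' {}T x {}T' Dq _ IH].
  by apply: reach_last; rewrite /= Dq.
by apply: reach_step IH; rewrite /= Dq.
Qed.

Lemma reach_seq c1 c2 n1 n2 (q : ctrl c1) T T1 T2 :
  reach n1 q T T1 -> reach n2 (entry c2) T1 T2 ->
  @reach (Seq c1 c2) (n1 + n2) (inl q) T T2.
Proof.
move=> R1 R2; elim: R1 R2 => [{}q {}T x Dq|{}n1 {}q q' {}T x T' Dq _ IH] R2.
  by apply: reach_step (reach_seq_r c1 R2); rewrite /= Dq.
by apply: reach_step (IH R2); rewrite /= Dq.
Qed.

Lemma reach_case i f o n (q : ctrl (f o)) T T' :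
  reach n q T T' ->
  @reach (Case i f) n (Some (Tagged (fun o => ctrl (f o)) q)) T T'.
Proof.
elim=> [{}q {}T x Dq|{}n {}q q' {}T x {}T' Dq _ IH].
  by apply: reach_last; rewrite /= Dq.
by apply: reach_step IH; rewrite /= Dq.
Qed.

Lemma reach_loop i f b n1 n2 (q : ctrl (f b)) T T1 T2 :
  reach n1 q T T1 -> @reach (Loop i f) n2 None T1 T2 ->
  @reach (Loop i f) (n1 + n2) (Some (Tagged (fun b => ctrl (f b)) q)) T T2.
Proof.
move=> R1 R2; elim: R1 R2 => [{}q {}T x Dq|{}n1 {}q q' {}T x T' Dq _ IH] R2.
  by apply: reach_step R2; rewrite /= Dq.
by apply: reach_step (IH R2); rewrite /= Dq.
Qed.

(* Popping leaves blanks on the left of the head, and writing a blank past the *)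
(* bottom lengthens the explicit part of the tape.                             *)
Definition holds_stack (w : seq bool) (t : tape void) : Prop :=
  exists j1 j2, t = (nseq j1 None, [seq Some (inl b) | b <- w] ++ nseq j2 None).

Definition represents (s : state) (T : tapes) : Prop :=
  forall i : 'I_K.+1, holds_stack (s i) (T i).

Lemma stack_read w t : holds_stack w t -> bit_of (tape_read t) = ohead w.
Proof. by case=> j1 [j2 ->]; case: w j2 => [|b w] [|j2]. Qed.

Lemma stack_keep w t :
  holds_stack w t -> holds_stack w (tape_write (tape_read t) t).
Proof.
case=> j1 [j2 ->]; exists j1; case: w j2 => [|b w] [|j2].
- by exists 1.
- by exists j2.+1.
- by exists 0.
by exists j2.+1.
Qed.

Lemma stack_pop w t :
  holds_stack w t ->
  holds_stack (behead w) (tape_move Right (tape_write None t)).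
Proof.
case=> j1 [j2 ->]; exists j1.+1; case: w j2 => [|b w] [|j2].
- by exists 0.
- by exists j2.
- by exists 0.
by exists j2.+1.
Qed.

Lemma stack_push w t b : holds_stack w t ->
  let t1 := tape_move Left (tape_write (tape_read t) t) in
  holds_stack (b :: w) (tape_write (Some (inl b)) t1).
Proof.
(* Moving left uses up one of the blanks left by earlier pops, if there is any. *)
move=> /stack_keep [j1 [j2 ->]]; exists j1.-1, j2.
by rewrite /tape_write /=; case: j1.
Qed.

Lemma bit_top (s : state) T i : i < K.+1 -> represents s T ->
  bit_of (reads T (inord i)) = ohead (s i).
Proof.
by move=> lt_iK /(_ (inord i)); rewrite inordK // ffunE => /stack_read.
Qed.

Lemma represents_pop (s : state) T i : represents s T ->
  represents (upd s i (behead (s i))) (acted (act_on i (None, Right) (reads T)) T).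
Proof.
move=> rT j; rewrite /acted /upd /act_on !ffunE /= -[eqn j i]/(val j == i).
case: (val j =P i) => [<-|_]; first exact: (stack_pop (rT j)).
exact: (stack_keep (rT j)).
Qed.

(** A total-correctness triple with a time bound. It covers all tapes that represent [s], so that
    stray blanks are forgotten from one command to the next. *)
Definition runs (c : cmd) (s : state) (t : nat) (s' : state) : Prop :=
  forall T, represents s T ->
    exists n T', [/\ n <= t, reach n (entry c) T T' & represents s' T'].

(** States are functions and are only compared pointwise. Applied with unknown [t] and [s1], this
    leaves three goals: the run, its final state, its time. *)
Lemma runs_weak c s t t' s1 s2 :
  runs c s t s1 -> s1 =1 s2 -> t <= t' -> runs c s t' s2.
Proof.
move=> R1 E le_t T /R1[n [T' [le_n Rn rT']]]; exists n, T'.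
by split=> // [|i]; [apply: leq_trans le_t | rewrite -E].
Qed.

Lemma runs_skip s : runs Skip s 1 s.
Proof.
move=> T rT; exists 1, (acted (keep (reads T)) T).
split=> //; first exact: reach_last.
by move=> i; rewrite /acted /keep !ffunE; apply: (stack_keep (rT i)).
Qed.

Lemma runs_push i b s : runs (Push i b) s 2 (upd s i (b :: s i)).
Proof.
move=> T rT; exists 2; eexists; split=> //.
  by apply: reach_step => //; apply: reach_last.
move=> j; rewrite /acted /upd /act_on /= !ffunE -[eqn j i]/(val j == i).
case: eqP => [Eji|_]; last exact: (stack_keep (stack_keep (rT j))).
by rewrite -Eji inord_val; apply: (stack_push _ (rT j)).
Qed.

Lemma runs_seq c1 c2 s t1 s1 t2 s2 :
  runs c1 s t1 s1 -> runs c2 s1 t2 s2 -> runs (Seq c1 c2) s (t1 + t2) s2.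
Proof.
move=> R1 R2 T /R1[n1 [T1 [le1 Rn1 /R2[n2 [T2 [le2 Rn2 rT2]]]]]].
exists (n1 + n2), T2; split=> //; first exact: leq_add.
exact: reach_seq Rn2.
Qed.

Lemma runs_case i f s t s' : i < K.+1 ->
  runs (f (ohead (s i))) (upd s i (behead (s i))) t s' ->
  runs (Case i f) s t.+1 s'.
Proof.
move=> lt_iK R T rT; have /R[n [T' [le_n Rn rT']]] := represents_pop i rT.
exists n.+1, T'; split=> //.
by apply: reach_step (reach_case i Rn); rewrite /= (bit_top lt_iK rT).
Qed.

Lemma runs_loop_nil i f s : i < K.+1 -> s i = [::] -> runs (Loop i f) s 1 s.
Proof.
move=> lt_iK s_i T rT; exists 1, (acted (act_on i (None, Right) (reads T)) T).
split=> //.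
  by apply: reach_last; rewrite /= (bit_top lt_iK rT) s_i.
move=> j; have := represents_pop i rT j; rewrite /upd -[eqn j i]/(val j == i).
by case: eqP => // ->; rewrite s_i.
Qed.

Lemma runs_loop_cons i f s b w t1 s1 t2 s2 : i < K.+1 -> s i = b :: w ->
  runs (f b) (upd s i w) t1 s1 -> runs (Loop i f) s1 t2 s2 ->
  runs (Loop i f) s (t1 + t2).+1 s2.
Proof.
move=> lt_iK s_i R1 R2 T rT; have := represents_pop i rT.
rewrite s_i => /R1[n1 [T1 [le1 Rn1 /R2[n2 [T2 [le2 Rn2 rT2]]]]]].
exists (n1 + n2).+1, T2; split=> //; first exact: leq_add.
by apply: reach_step (reach_loop Rn1 Rn2); rewrite /= (bit_top lt_iK rT) s_i.
Qed.

Definition machine (c : cmd) : turing_machine :=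
  @TuringMachine (option (ctrl c)) void K (Some (entry c)) (fun q => q == None)
    (fun q a => if q is Some q' then
       let: (r, x) := delta a q' in (r, finfun x)
     else (None, [ffun=> (None, Stay)])).

Lemma reach_steps c n (q : ctrl c) T T' : reach n q T T' ->
  iter n (@step (machine c)) (Some q, T) = (None, T').
Proof.
elim=> [{}q {}T x Dq|{}n {}q q' {}T x {}T' Dq _ IH]; rewrite ?iterSr /=.
  rewrite /step /= -/(reads T) Dq /=.
  by congr pair; apply/ffunP=> i; rewrite !ffunE.
rewrite -IH; congr iter; rewrite /step /= -/(reads T) Dq /=.
by congr pair; apply/ffunP=> i; rewrite !ffunE.
Qed.

Lemma runs_outputs c (w : seq bool) t s :
  runs c (upd (fun=> [::]) 0 w) t s -> outputs_within (machine c) t w (s 0).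
Proof.
move=> R; have [|n [T [le_n Rn rT]]] := R [ffun i : 'I_K.+1 =>
    if i == ord0 then @word_tape (machine c) w else ([::], [::])].
  move=> i; rewrite ffunE /upd -[eqn i 0]/(i == ord0); case: eqP => _.
    by exists 0, 0; rewrite cats0.
  by exists 0, 0.
(* The machine halts after [n <= t] steps and then stays put, which pads the run to exactly [t]
   steps. *)
rewrite /outputs_within -(subnK le_n) iterD -[iter n _ _]/(iter _ _ (_, _)).
rewrite (reach_steps Rn) {R Rn}.
have ->: iter (t - n) (@step (machine c)) (None, T) = (None, T).
  by elim: (t - n) => //= j ->.
split=> //; rewrite /output /=.
have [j1 [j2 ->]] := rT ord0.
by elim: (s _) => [|b v /= ->] //; case: j2.
Qed.

End Compilation.

(** * The program of the kernel *)

Arguments upd s i w j /.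

(* Stacks: the data; the header numbers m, n, p, k; scratch stacks; n, p and k *)
(* in unary; the surpluses e = n - k and f = p - k; the conjunction A of all   *)
(* vectors; G, nonempty while the current vector is all ones; R and X, the     *)
(* flags of the dropped vectors and coordinates; Bad, nonempty if the answer   *)
(* is no; Z, nonempty if there is no data. A primed stack receives what is     *)
(* popped from the unprimed one, except that E' is the part of E that remains  *)
(* to be dropped from the current V^i.                                         *)
Local Notation rDat := 0 (only parsing).
Local Notation rM := 1 (only parsing).
Local Notation rN := 2 (only parsing).
Local Notation rP := 3 (only parsing).
Local Notation rK := 4 (only parsing).
Local Notation rTmp := 5 (only parsing).
Local Notation rH := 6 (only parsing).
Local Notation rUN := 7 (only parsing).
Local Notation rUP := 8 (only parsing).
Local Notation rUK := 9 (only parsing).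
Local Notation rV := 10 (only parsing).
Local Notation rDat' := 11 (only parsing).
Local Notation rE := 12 (only parsing).
Local Notation rF := 13 (only parsing).
Local Notation rA := 14 (only parsing).
Local Notation rA' := 15 (only parsing).
Local Notation rE' := 16 (only parsing).
Local Notation rUN' := 17 (only parsing).
Local Notation rUP' := 18 (only parsing).
Local Notation rG := 19 (only parsing).
Local Notation rR := 20 (only parsing).
Local Notation rX := 21 (only parsing).
Local Notation rX' := 22 (only parsing).
Local Notation rBad := 23 (only parsing).
Local Notation rZ := 24 (only parsing).

Local Notation run := (runs 24).

Local Ltac split_reg k n :=
  lazymatch n with
  | 0 => idtac
  | S ?m => destruct k as [|k]; [ | split_reg k m]
  end.

(** Compares two states register by register: the 25 stacks in use, then all other indices at
    once. *)
Local Ltac pointwise :=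
  let k := fresh "k" in intro k; split_reg k constr:(25); try by [].

Local Notation "c1 ;; c2" := (Seq c1 c2) (at level 65, right associativity).

(** * Moving and copying stacks *)

Definition move_to i j := Loop i (fun b => Push j b).
Definition drain i := Loop i (fun _ => Skip).
Definition copy i j := move_to i rTmp ;; Loop rTmp (fun b => Push i b ;; Push j b).

Lemma updE s i w j : upd s i w j = if j == i then w else s j.
Proof. by []. Qed.

Lemma run_move i j s : i < 25 -> i != j ->
  run (move_to i j) s (3 * size (s i) + 1)
      (upd (upd s i [::]) j (catrev (s i) (s j))).
Proof.
move=> lt_i ne_ij; move Ew: (s i) => w; elim: w s Ew => [|b w IH] s s_i.
  apply: (runs_weak (runs_loop_nil _ lt_i s_i)) => // k; rewrite !updE.
  by case: eqP => [->//|_]; case: eqP => [->|].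
eapply runs_weak.
- apply: (runs_loop_cons lt_i s_i); [exact: runs_push | apply: IH].
  by rewrite !updE (negPf ne_ij) eqxx.
- move=> k; rewrite !updE eqxx (eq_sym j) (negPf ne_ij).
  by case: eqP => // _; case: eqP.
rewrite /=; lia.
Qed.

Lemma run_drain i s : i < 25 ->
  run (drain i) s (2 * size (s i) + 1) (upd s i [::]).
Proof.
move=> lt_i; move Ew: (s i) => w; elim: w s Ew => [|b w IH] s s_i.
  apply: (runs_weak (runs_loop_nil _ lt_i s_i)) => // k; rewrite updE.
  by case: eqP => [->|].
eapply runs_weak.
- apply: (runs_loop_cons lt_i s_i); [exact: runs_skip | apply: IH].
  by rewrite updE eqxx.
- by move=> k; rewrite !updE; case: eqP.
rewrite /=; lia.
Qed.

Lemma run_copy i j s : i < 25 -> j < 25 -> i != j -> i != rTmp -> j != rTmp ->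
  s rTmp = [::] ->
  run (copy i j) s (8 * size (s i) + 2) (upd s j (s i ++ s j)).
Proof.
move=> lt_i lt_j ne_ij ne_it ne_jt s_t.
have back w s0 : s0 rTmp = w -> run (Loop rTmp (fun b => Push i b ;; Push j b))
    s0 (5 * size w + 1) (upd (upd (upd s0 rTmp [::]) i (catrev w (s0 i)))
                             j (catrev w (s0 j))).
  elim: w s0 => [|b w IH] {s_t} s s_t.
    apply: (runs_weak (runs_loop_nil _ _ s_t)) => // k; rewrite !updE.
    by case: eqP => [->//|_]; case: eqP => [->//|_]; case: eqP => [->|].
  eapply runs_weak.
  - apply: (runs_loop_cons _ s_t) => //.
      by apply: runs_seq; apply: runs_push.
    by apply: IH; rewrite !updE !(eq_sym rTmp) (negPf ne_it) (negPf ne_jt).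
  - move=> k; rewrite !updE !eqxx (eq_sym j i) (negPf ne_ij) (negPf ne_it).
    rewrite (negPf ne_jt).
    by case: eqP => // _; case: eqP => // _; case: eqP.
  rewrite /=; lia.
eapply runs_weak.
- rewrite /copy; eapply runs_seq; first exact: run_move.
  exact: (back _ _ erefl).
- move=> k; rewrite !updE eqxx (eq_sym j i) (negPf ne_ij) (negPf ne_it).
  rewrite (negPf ne_jt) eqxx s_t -/(rev (s i)) !catrevE revK cats0.
  case: eqP => // _; case: eqP => [->|_]; first by [].
  by case: eqP => [->|].
by rewrite !updE eqxx s_t -/(rev (s i)) size_rev; lia.
Qed.

(* Header numbers are kept with their most significant digit on top. *)
Definition parse h :=
  Push rTmp true ;;
  Loop rTmp (fun _ => Case rDat (fun o => if o is Some true then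
      Case rDat (fun o => if o is Some b then Push h b ;; Push rTmp true else Skip)
    else Skip)).

(** [rTmp] is the loop flag: a new [true] is pushed on it only after a digit preceded by 1, so the
    delimiter ends the loop. Digits are pushed as they are read, least significant first, hence the
    [rev]. *)
Lemma run_parse h x d s : h \in [:: rM; rN; rP; rK] ->
  s rDat = encode_nat x ++ d -> s rTmp = [::] -> s h = [::] ->
  run (parse h) s (8 * size (encode_nat x)) (upd (upd s rDat d) h (rev (binary x))).
Proof.
move=> h_in s_d s_t s_h.
have loop w s0 : s0 rDat = flatten [seq [:: true; b] | b <- w] ++ false :: d ->
    s0 rTmp = [:: true] ->
    run (Loop rTmp (fun _ => Case rDat (fun o => if o is Some true then
      Case rDat (fun o => if o is Some b then Push h b ;; Push rTmp true else Skip)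
    else Skip))) s0 (8 * size w + 5)
      (upd (upd (upd s0 rTmp [::]) rDat d) h (catrev w (s0 h))).
  elim: w s0 => [|b w IH] {s_d s_t s_h} s s_d s_t.
    eapply runs_weak.
    - apply: (runs_loop_cons _ s_t) => //.
        by apply: runs_case => //=; rewrite s_d /=; apply: runs_skip.
      by apply: runs_loop_nil.
    - by move: h_in; rewrite !inE => /or4P[] /eqP->; pointwise.
    by [].
  eapply runs_weak.
  - apply: (runs_loop_cons _ s_t) => //.
    + apply: runs_case => //=; rewrite s_d /=; apply: runs_case => //=.
      by apply: runs_seq; apply: runs_push.
    apply: IH.
    + by move: h_in; rewrite !inE => /or4P[] /eqP->.
    + by move: h_in; rewrite !inE => /or4P[] /eqP->.
  - by move: h_in; rewrite !inE => /or4P[] /eqP->; pointwise.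
  - rewrite /=; lia.
eapply runs_weak.
- rewrite /parse; eapply runs_seq; first exact: runs_push.
  apply: (loop (binary x)); first by rewrite /= s_d /encode_nat -catA.
  by rewrite /= s_t.
- by move: h_in; rewrite !inE => /or4P[] /eqP E; subst h; pointwise;
     rewrite //= s_h.
- rewrite /encode_nat size_cat size_flatten /shape -map_comp.
  rewrite (@eq_map _ _ _ (fun=> 2)) // sumnE big_map big_const_seq count_predT.
  rewrite iter_addn_0 /=; lia.
Qed.

(** * Unary numbers capped at the length of the data *)

Definition ones n := nseq n true.

Lemma ones_rcons n : rcons (ones n) true = ones n.+1.
Proof. by elim: n => //= n ->. Qed.

Lemma catrev_ones m n : catrev (ones m) (ones n) = ones (m + n).
Proof. by elim: m n => [|m IH] n //; rewrite addSnnS -IH. Qed.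

(* The number k may be exponential in the length of the input, so it cannot be *)
(* written in unary. Numbers are capped at the length of the data, which is    *)
(* not less than n and p when there is data.                                   *)
Definition cap_double u b :=
  Loop u (fun _ => Push rV true ;; Push rV true) ;;
  (if b then Push rV true else Skip) ;;
  Loop rDat (fun x => Push rDat' x ;;
    Case rV (fun o => if o is Some _ then Push u true else Skip)) ;;
  drain rV ;; move_to rDat' rDat.

(** The double is built on [rV]; then each bit of the data lets one token pass from [rV] to [u],
    which takes the minimum, and the excess is drained. The bound on [m] limits the time of the
    doubling. *)
Lemma run_cap_double u b m s : u \in [:: rUN; rUP; rUK] ->
  s u = ones m -> s rV = [::] -> s rDat' = [::] -> m <= size (s rDat) ->
  run (cap_double u b) s (22 * size (s rDat) + 10)
    (upd s u (ones (minn (size (s rDat)) (b + m.*2)))).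
Proof.
move=> u_in s_u s_v s_d' le_m.
have dbl i v s0 : s0 u = ones i -> s0 rV = ones v ->
    run (Loop u (fun _ => Push rV true ;; Push rV true)) s0 (5 * i + 1)
      (upd (upd s0 u [::]) rV (ones (i.*2 + v))).
  elim: i v s0 => [|i IH] v {s_u s_v s_d' le_m}s s_u s_v.
    eapply runs_weak.
    - by apply: runs_loop_nil => //; move: u_in; rewrite !inE => /or3P[] /eqP->.
    - by move: u_in; rewrite !inE => /or3P[] /eqP E; subst u; pointwise.
    by [].
  eapply runs_weak.
  - apply: (runs_loop_cons _ s_u) => //.
    + by move: u_in; rewrite !inE => /or3P[] /eqP->.
    + by apply: runs_seq; apply: runs_push.
    apply: (IH v.+2).
    + by move: u_in; rewrite !inE => /or3P[] /eqP->.
    by move: u_in; rewrite !inE => /or3P[] /eqP E; subst u; rewrite /= s_v.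
  - by move: u_in; rewrite !inE => /or3P[] /eqP E; subst u; pointwise;
      rewrite /= !addnS.
  rewrite /=; lia.
have trunc d i v s0 : s0 rDat = d -> s0 u = ones i -> s0 rV = ones v ->
    run (Loop rDat (fun x => Push rDat' x ;;
        Case rV (fun o => if o is Some _ then Push u true else Skip)))
      s0 (6 * size d + 1)
      (upd (upd (upd (upd s0 rDat [::]) rDat' (catrev d (s0 rDat')))
         rV (ones (v - size d))) u (ones (minn (size d) v + i))).
  elim: d i v s0 => [|x d IH] i v {s_u s_v s_d' le_m}s s_d s_u s_v.
    eapply runs_weak.
    - by apply: runs_loop_nil.
    - by move: u_in; rewrite !inE => /or3P[] /eqP E; subst u; pointwise;
        rewrite /= ?subn0 ?min0n.
    by [].
  case: v s_v => [|v] s_v.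
    eapply runs_weak.
    - apply: (runs_loop_cons _ s_d) => //.
        apply: runs_seq; first exact: runs_push.
        by apply: runs_case => //=; rewrite s_v /=; apply: runs_skip.
      by apply: (IH i 0);
        move: u_in; rewrite !inE => /or3P[] /eqP E; subst u.
    - by move: u_in; rewrite !inE => /or3P[] /eqP E; subst u; pointwise;
        rewrite /= ?minn0.
    rewrite /=; lia.
  eapply runs_weak.
  - apply: (runs_loop_cons _ s_d) => //.
      apply: runs_seq; first exact: runs_push.
      by apply: runs_case => //=; rewrite s_v /=; apply: runs_push.
    by apply: (IH i.+1 v);
      move: u_in; rewrite !inE => /or3P[] /eqP E; subst u; rewrite //= s_u.
  - by move: u_in; rewrite !inE => /or3P[] /eqP E; subst u; pointwise;
      rewrite /= ?minnSS ?addnS.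
  rewrite /=; lia.
eapply runs_weak.
- rewrite /cap_double; eapply runs_seq; first exact: (dbl m 0).
  eapply runs_seq.
    instantiate (1 := upd (upd s u [::]) rV (ones (b + m.*2))).
    instantiate (1 := 2).
    case: b; eapply runs_weak.
    + exact: runs_push.
    + by move: u_in; rewrite !inE => /or3P[] /eqP E; subst u; pointwise;
        rewrite /= addn0.
    + by [].
    + exact: runs_skip.
    + by move: u_in; rewrite !inE => /or3P[] /eqP E; subst u; pointwise;
        rewrite /= addn0.
    + by [].
  eapply runs_seq.
    apply: (trunc (s rDat) 0 (b + m.*2)).
    + by move: u_in; rewrite !inE => /or3P[] /eqP E; subst u.
    + by move: u_in; rewrite !inE => /or3P[] /eqP E; subst u.
    + by [].
  eapply runs_seq; first exact: run_drain.
  exact: run_move.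
- by move: u_in; rewrite !inE => /or3P[] /eqP E; subst u; pointwise;
    rewrite /= ?s_d' ?addn0 // -/(rev (s 0)) catrevE revK cats0.
have -> : upd (upd (upd (upd (upd (upd s u [::]) 10 (ones (b + m.*2))) 0
     [::]) 11 (catrev (s 0) (upd (upd s u [::]) 10 (ones (b + m.*2)) 11)))
     10 (ones (b + m.*2 - size (s 0)))) u (ones (minn (size (s 0)) (b + m.*2) + 0)) 10 =
     ones (b + m.*2 - size (s 0)).
  by move: u_in; rewrite !inE => /or3P[] /eqP E; subst u.
set dd := upd _ _ _ rDat'.
have -> : dd = rev (s rDat).
  by move: u_in; rewrite /dd !inE => /or3P[] /eqP E; subst u; rewrite /= s_d'.
rewrite size_rev size_nseq; case: (b) le_m; lia.
Qed.

(** Horner's rule, in the order in which the header stacks yield the digits. The induction is on a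
    number of digits [k] with [x < 2 ^ k], and halves [x]. *)
Lemma binaryK x : foldl (fun m (b : bool) => b + m.*2) 0 (rev (binary x)) = x.
Proof.
rewrite foldl_rev /binary; have := up_logP x.+1 (isT : 1 < 2).
move: (up_log 2 x.+1) => k; elim: k x => [|k IH] x lt_x /=; first by case: x lt_x.
rewrite expn0 divn1 (iotaDl 1 0) -map_comp.
have /IH: x./2 < 2 ^ k by move: lt_x; rewrite expnS; lia.
rewrite /mkseq => E; rewrite -[RHS]odd_double_half -[in RHS]E.
congr (_ + (foldr _ _ _).*2); apply: eq_map => i /=.
by rewrite expnS divnMA divn2.
Qed.

Lemma binary_nil x : binary x = [::] -> x = 0.
Proof. by move=> E; rewrite -[x]binaryK E. Qed.

Definition unary h u :=
  Loop h (fun b => Push rH b ;; cap_double u b) ;; move_to rH h.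

(** Capping at every Horner step amounts to capping once at the end: once the value reaches the cap,
    doubling keeps it there. *)
Lemma run_unary h u x s :
  (h, u) \in [:: (rN, rUN); (rP, rUP); (rK, rUK)] -> s h = rev (binary x) ->
  s u = [::] -> s rV = [::] -> s rDat' = [::] -> s rH = [::] ->
  run (unary h u) s (size (binary x) * (22 * size (s rDat) + 16) + 2)
    (upd s u (ones (minn (size (s rDat)) x))).
Proof.
move=> hu_in s_h s_u s_v s_d' s_H.
have u_in : u \in [:: rUN; rUP; rUK].
  by move: hu_in; rewrite !inE => /or3P[] /eqP[_ ->].
have loop w m s0 : s0 h = w -> s0 u = ones (minn (size (s0 rDat)) m) ->
    s0 rV = [::] -> s0 rDat' = [::] ->
    run (Loop h (fun b => Push rH b ;; cap_double u b)) s0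
      (size w * (22 * size (s0 rDat) + 13) + 1)
      (upd (upd (upd s0 h [::]) rH (catrev w (s0 rH))) u
         (ones (minn (size (s0 rDat))
            (foldl (fun m (b : bool) => b + m.*2) m w)))).
  elim: w m s0 => [|b w IH] m {s_h s_u s_v s_d' s_H}s s_h s_u s_v s_d'.
    eapply runs_weak.
    - by apply: runs_loop_nil => //; move: hu_in; rewrite !inE => /or3P[] /eqP[-> _].
    - by move: hu_in; rewrite !inE => /or3P[] /eqP[??]; subst h u; pointwise.
    by [].
  eapply runs_weak.
  - apply: (runs_loop_cons _ s_h) => //.
    + by move: hu_in; rewrite !inE => /or3P[] /eqP[-> _].
    + apply: runs_seq; first exact: runs_push.
      apply: (run_cap_double b (m := minn (size (s rDat)) m)) => //;
        move: hu_in; rewrite !inE => /or3P[] /eqP[??]; subst h u => //=;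
        exact: geq_minl.
    by apply: (IH (b + m.*2));
      move: hu_in; rewrite !inE => /or3P[] /eqP[??]; subst h u => //=;
      congr ones; lia.
  - by move: hu_in; rewrite !inE => /or3P[] /eqP[??]; subst h u; pointwise.
  move: hu_in; rewrite !inE => /or3P[] /eqP[??]; subst h u; rewrite /=; lia.
eapply runs_weak.
- rewrite /unary; eapply runs_seq; first exact: (loop _ 0 s s_h).
  by apply: run_move => //; move: hu_in; rewrite !inE => /or3P[] /eqP[-> _].
- by move: hu_in; rewrite !inE => /or3P[] /eqP[??]; subst h u; pointwise;
    rewrite /= ?binaryK ?s_h ?s_H // -/(rev _) !catrevE !revK cats0.
have -> : forall a b c : seq bool, upd (upd (upd s h a) rH b) u c rH = b.
  by move: hu_in; rewrite !inE => /or3P[] /eqP[??]; subst h u.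
by rewrite s_H -/(rev _) !size_rev; lia.
Qed.

(** * Surpluses and minima *)

Definition subtract u v e :=
  copy u e ;; Loop v (fun _ => Push rTmp true ;; Case e (fun _ => Skip)) ;;
  move_to rTmp v.

(** Popping from an empty [e] has no effect, which gives truncated subtraction. *)
Lemma run_subtract u e m k s : (u, e) \in [:: (rUN, rE); (rUP, rF)] ->
  s u = ones m -> s rUK = ones k -> s e = [::] -> s rTmp = [::] ->
  run (subtract u rUK e) s (8 * m + 8 * k + 4) (upd s e (ones (m - k))).
Proof.
move=> ue_in s_u s_k s_e s_t.
have loop i j s0 : s0 rUK = ones i -> s0 e = ones j ->
    run (Loop rUK (fun _ => Push rTmp true ;; Case e (fun _ => Skip))) s0
      (5 * i + 1) (upd (upd (upd s0 rUK [::]) rTmp (catrev (ones i) (s0 rTmp)))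
         e (ones (j - i))).
  elim: i j s0 => [|i IH] j {s_u s_k s_e s_t}s s_k s_e.
    eapply runs_weak.
    - exact: runs_loop_nil.
    - by move: ue_in; rewrite !inE => /orP[] /eqP[??]; subst u e; pointwise;
        rewrite /= subn0.
    by [].
  eapply runs_weak.
  - apply: (runs_loop_cons _ s_k) => //.
      apply: runs_seq; first exact: runs_push.
      apply: runs_case; last exact: runs_skip.
      by move: ue_in; rewrite !inE => /orP[] /eqP[_ ->].
    by apply: (IH j.-1);
      move: ue_in; rewrite !inE => /orP[] /eqP[??]; subst u e; rewrite //= s_e;
      case: (j).
  - by move: ue_in; rewrite !inE => /orP[] /eqP[??]; subst u e; pointwise;
      rewrite /=; congr ones; lia.
  rewrite /=; lia.
eapply runs_weak.
- rewrite /subtract; eapply runs_seq.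
    by apply: run_copy; move: ue_in; rewrite !inE => /orP[] /eqP[??]; subst u e.
  eapply runs_seq.
    by apply: (loop k m);
      move: ue_in; rewrite !inE => /orP[] /eqP[??]; subst u e;
      rewrite //= s_u s_e cats0.
  exact: run_move.
- by move: ue_in; rewrite !inE => /orP[] /eqP[??]; subst u e; pointwise;
    rewrite /= s_t ?s_k // !(catrev_ones _ 0) !addn0.
set l := size (_ rTmp).
have -> : l = k.
  rewrite /l; move: ue_in; rewrite !inE => /orP[] /eqP[??]; subst u e;
  by rewrite /= s_t -/(rev _) size_rev size_nseq.
by rewrite s_u size_nseq; lia.
Qed.

(** When there is data, the surplus [e] is nonzero exactly if the number on [h] exceeds the budget;
    replacing it by the budget then yields the minimum of the two. *)
Definition clamp e h :=
  Case e (fun o => if o is Some b then Push e b ;; drain h ;; copy rK h else Skip).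

Lemma run_clamp e h s : (e, h) \in [:: (rE, rN); (rF, rP)] -> s rTmp = [::] ->
  run (clamp e h) s (2 * size (s h) + 8 * size (s rK) + 6)
    (upd s h (if s e is [::] then s h else s rK)).
Proof.
move=> eh_in s_t; case s_e: (s e) => [|b w]; eapply runs_weak.
- apply: runs_case; first by move: eh_in; rewrite !inE => /orP[] /eqP[-> _].
  by rewrite s_e; apply: runs_skip.
- by move: eh_in; rewrite !inE => /orP[] /eqP[??]; subst e h; pointwise;
    rewrite /= s_e.
- by lia.
- apply: runs_case; first by move: eh_in; rewrite !inE => /orP[] /eqP[-> _].
  rewrite s_e; eapply runs_seq; first exact: runs_push.
  eapply runs_seq.
    by apply: run_drain; move: eh_in; rewrite !inE => /orP[] /eqP[_ ->].
  by apply: run_copy; move: eh_in; rewrite !inE => /orP[] /eqP[??]; subst e h.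
- by move: eh_in; rewrite !inE => /orP[] /eqP[??]; subst e h; pointwise;
    rewrite //= ?cats0 // s_e.
by move: eh_in; rewrite !inE => /orP[] /eqP[??]; subst e h; rewrite /=; lia.
Qed.

(** * Reading the data *)

(** Greedy flags for dropping: [true] on the first [e] elements that satisfy [P]. It serves both for
    vectors and for coordinates. *)
Fixpoint drops (T : Type) (P : pred T) (e : nat) (s : seq T) : seq bool :=
  if s is x :: s' then (P x && (0 < e)) :: drops P (e - P x) s' else [::].

Definition vand (v a : seq bool) := [seq x.1 && x.2 | x <- zip v a].

Definition read_row :=
  Loop rUP (fun _ => Push rUP' true ;; Case rDat (fun o =>
    if o is Some b then
      Push rDat' b ;; Case rA (fun a => Push rA' (b && odflt false a)) ;;
      (if b then Skip else Case rG (fun _ => Skip))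
    else Skip)) ;;
  move_to rA' rA ;; move_to rUP' rUP.

Lemma run_read_row v d a g s : size a = size v ->
  s rUP = ones (size v) -> s rDat = v ++ d -> s rA = a -> s rG = ones (g : bool) ->
  s rA' = [::] -> s rUP' = [::] ->
  run read_row s (18 * size v + 3)
    (upd (upd (upd (upd s rDat d) rDat' (catrev v (s rDat')))
      rA (vand v a)) rG (ones (g && all id v))).
Proof.
move=> sz s_p s_d s_a s_g s_a' s_p'.
have reset (b : bool) s0 : run (if b then Skip else Case rG (fun _ => Skip)) s0 2
    (upd s0 rG (if b then s0 rG else behead (s0 rG))).
  case: b; last by apply: runs_case => //; apply: runs_skip.
  by eapply runs_weak; [exact: runs_skip | pointwise |].
have loop d0 a0 v0 s0 (g0 : bool) : size a0 = size v0 -> s0 rUP = ones (size v0) ->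
    s0 rDat = v0 ++ d0 -> s0 rA = a0 -> s0 rG = ones g0 ->
    run (Loop rUP (fun _ => Push rUP' true ;; Case rDat (fun o =>
      if o is Some b then
        Push rDat' b ;; Case rA (fun a => Push rA' (b && odflt false a)) ;;
        (if b then Skip else Case rG (fun _ => Skip))
      else Skip))) s0 (11 * size v0 + 1)
     (upd (upd (upd (upd (upd (upd (upd s0 rUP [::]) rDat d0)
       rDat' (catrev v0 (s0 rDat')))
       rA [::]) rA' (catrev (vand v0 a0) (s0 rA'))) rG (ones (g0 && all id v0)))
       rUP' (catrev (ones (size v0)) (s0 rUP'))).
  elim: v0 a0 s0 g0 => [|b v0 IH] [|x a0] //= {sz s_p s_d s_a s_g s_a' s_p'}s {}g.
    move=> _ s_p s_d s_a s_g; eapply runs_weak.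
    - exact: runs_loop_nil.
    - by pointwise; rewrite /= andbT.
    by [].
  move=> [sz] s_p s_d s_a s_g; eapply runs_weak.
  - apply: (runs_loop_cons _ s_p) => //.
      eapply runs_seq; first exact: runs_push.
      apply: runs_case => //; rewrite /= s_d /=.
      eapply runs_seq; first exact: runs_push.
      eapply runs_seq.
        by apply: runs_case => //; rewrite /= s_a /=; apply: runs_push.
      exact: reset.
    apply: (IH a0 _ (b && g)) => //; case: (b) => //=.
    by rewrite s_g; case: (g).
  - by case: (b); pointwise; rewrite /= ?andbF // andbC.
  rewrite /=; lia.
eapply runs_weak.
- rewrite /read_row; eapply runs_seq; first by apply: (loop d a v s g).
  by eapply runs_seq; apply: run_move.
- by pointwise; rewrite /= ?s_a' ?s_p' ?s_p -?/(rev (vand v a)) ?(catrev_ones _ 0)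
     ?catrevE ?cats0 ?revK ?addn0.
rewrite /= s_a' s_p' !(catrev_ones _ 0) -/(rev _) size_rev !size_nseq.
by rewrite size_map size_zip sz minnn; lia.
Qed.

Definition row_flag := Case rG (fun g => if g is Some _
  then Case rE' (fun o => Push rR (o != None)) else Push rR false).

Lemma run_row_flag (g : bool) e s : s rG = ones g -> s rE' = ones e ->
  run row_flag s 4 (upd (upd (upd s rG [::]) rE' (ones (e - g)))
    rR ((g && (0 < e)) :: s rR)).
Proof.
move=> s_g s_e; eapply runs_weak.
- apply: runs_case => //.
  instantiate (2 := 3); instantiate (1 := upd (upd (upd s rG [::]) rE' (ones (e - g)))
    rR ((g && (0 < e)) :: s rR)).
  rewrite s_g; case: (g) => /=; eapply runs_weak.
  + by apply: runs_case => //; apply: runs_push.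
  + by case: e s_e => [|e] s_e; pointwise; rewrite /= s_e //= subn1.
  + by [].
  + exact: runs_push.
  + by pointwise; rewrite /= subn0.
  by [].
- by [].
by [].
Qed.

Definition read_set :=
  Loop rUN (fun _ => Push rUN' true ;; Push rG true ;; read_row ;; row_flag) ;;
  move_to rUN' rUN ;; Loop rE' (fun _ => Push rBad true).

Lemma run_flush i k s : i < 23 -> s i = ones k ->
  run (Loop i (fun _ => Push rBad true)) s (3 * k + 1)
    (upd (upd s i [::]) rBad (ones k ++ s rBad)).
Proof.
move=> lt_i; elim: k s => [|k IH] s s_i.
  eapply runs_weak; first by apply: runs_loop_nil => //; lia.
    move=> j; rewrite !updE; case: eqP => [->//|_].
    by case: eqP => // ->.
  by [].
eapply runs_weak.
- apply: (runs_loop_cons _ s_i); first by lia.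
    exact: runs_push.
  by apply: IH; rewrite !updE eqxx ltn_eqF.
- move=> j; rewrite !updE eqxx (gtn_eqF lt_i).
  case: eqP => // _; last by case: eqP.
  by rewrite -cat_rcons ones_rcons.
by lia.
Qed.

(** What is left on [rE'] after a set counts its missing all-ones vectors; flushing it to [rBad]
    records the negative answer. *)
Lemma run_read_set p (rows : seq (seq bool)) d a e s :
  all (fun v => size v == p) rows -> size a = p ->
  s rUN = ones (size rows) -> s rUP = ones p -> s rDat = flatten rows ++ d ->
  s rA = a -> s rE' = ones e -> s rG = [::] ->
  s rA' = [::] -> s rUP' = [::] -> s rUN' = [::] ->
  run read_set s (size rows * (18 * p + 15) + 3 * e + 3)
    (upd (upd (upd (upd (upd (upd s rDat d)
      rDat' (catrev (flatten rows) (s rDat')))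
      rA (foldl (fun a v => vand v a) a rows)) rE' [::])
      rR (catrev (drops (all id) e rows) (s rR)))
      rBad (ones (e - count (all id) rows) ++ s rBad)).
Proof.
move=> szs sz_a s_n s_p s_d s_a s_e s_g s_a' s_p' s_n'.
have loop e0 a0 rows0 d0 s0 : all (fun v => size v == p) rows0 -> size a0 = p ->
  s0 rUN = ones (size rows0) -> s0 rUP = ones p -> s0 rDat = flatten rows0 ++ d0 ->
  s0 rA = a0 -> s0 rE' = ones e0 -> s0 rG = [::] ->
  s0 rA' = [::] -> s0 rUP' = [::] ->
  run (Loop rUN (fun _ => Push rUN' true ;; Push rG true ;; read_row ;; row_flag))
    s0 (size rows0 * (18 * p + 12) + 1)
    (upd (upd (upd (upd (upd (upd (upd s0 rUN [::]) rDat d0)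
      rUN' (catrev (ones (size rows0)) (s0 rUN')))
      rDat' (catrev (flatten rows0) (s0 rDat')))
      rA (foldl (fun a v => vand v a) a0 rows0))
      rE' (ones (e0 - count (all id) rows0)))
      rR (catrev (drops (all id) e0 rows0) (s0 rR))).
  elim: rows0 a0 e0 s0 {szs sz_a s_n s_p s_d s_a s_e s_g s_a' s_p' s_n'}
    => [|v rows0 IH] {}a {}e {}s /=.
    move=> _ _ s_n s_p s_d s_a s_e s_g s_a' s_p'; eapply runs_weak.
    - exact: runs_loop_nil.
    - by pointwise; rewrite /= ?subn0.
    by [].
  move=> /andP[/eqP sz_v szs] sz_a s_n s_p s_d s_a s_e s_g s_a' s_p'.
  eapply runs_weak.
  - apply: (runs_loop_cons _ s_n) => //.
      eapply runs_seq; first exact: runs_push.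
      eapply runs_seq; first exact: runs_push.
      eapply runs_seq.
        apply: (@run_read_row v (flatten rows0 ++ d0) a true) => //=.
        + by rewrite sz_v.
        + by rewrite sz_v.
        + by rewrite s_d catA.
        by rewrite s_g.
      by apply: (@run_row_flag (all id v) e).
    apply: (IH (vand v a) (e - all id v)) => //=.
    by rewrite size_map size_zip sz_a sz_v minnn.
  - by pointwise; rewrite /= ?subnDA ?catrev_catr // -catrev_catl.
  rewrite sz_v /=; lia.
eapply runs_weak.
- rewrite /read_set; eapply runs_seq; first by apply: (loop e a rows d).
  eapply runs_seq; first by apply: run_move.
  exact: run_flush.
- by pointwise; rewrite /= s_n' !(catrev_ones _ 0) !addn0.
rewrite /= s_n' !(catrev_ones _ 0) !addn0 size_nseq; lia.
Qed.

(* The data end up reversed in rDat', which allows write_data to push them     *)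
(* back on rDat from the last bit to the first.                                *)
Definition read_data :=
  Loop rDat (fun b => Push rDat b ;; copy rE rE' ;; read_set).

(** The sets are never counted: the loop goes on while there is data, so every set has to contribute
    a bit. The bit popped by the test is pushed back by the body. *)
Lemma run_read_data n p e (V : seq (seq (seq bool))) a s :
  all (fun rows => flatten rows != [::]) V ->
  all (fun rows => size rows == n) V ->
  all (fun v => size v == p) (flatten V) -> size a = p ->
  s rUN = ones n -> s rUP = ones p -> s rDat = flatten (flatten V) ->
  s rA = a -> s rE = ones e -> s rE' = [::] -> s rG = [::] ->
  s rA' = [::] -> s rUP' = [::] -> s rUN' = [::] -> s rTmp = [::] ->
  run read_data s (size V * (n * (18 * p + 15) + 11 * e + 8) + 1)
    (upd (upd (upd (upd (upd s rDat [::])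
      rDat' (catrev (flatten (flatten V)) (s rDat')))
      rA (foldl (fun a v => vand v a) a (flatten V)))
      rR (catrev (flatten [seq drops (all id) e rows | rows <- V]) (s rR)))
      rBad (ones (\sum_(rows <- V) (e - count (all id) rows)) ++ s rBad)).
Proof.
elim: V a s => [|rows V IH] a s.
  move=> _ _ _ sz_a s_n s_p s_d s_a s_e s_e' s_g s_a' s_p' s_n' s_t.
  eapply runs_weak; first exact: runs_loop_nil.
    by pointwise; rewrite /= ?big_nil.
  by [].
rewrite /= all_cat flatten_cat.
move=> /andP[ne_rows ne_V] /andP[/eqP sz_rows szV] /andP[sz_v szVv] sz_a.
move=> s_n s_p s_d s_a s_e s_e' s_g s_a' s_p' s_n' s_t.
have [b [w Ew]] : exists b w, flatten rows = b :: w.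
  by case: (flatten rows) ne_rows => [//|b w]; exists b, w.
rewrite Ew in s_d; eapply runs_weak.
- apply: (runs_loop_cons _ s_d) => //.
    eapply runs_seq; first exact: runs_push.
    eapply runs_seq; first exact: run_copy.
    by apply: (@run_read_set p rows (flatten (flatten V)) a e);
      rewrite /= ?Ew ?s_e' ?cats0 ?sz_rows.
  apply: (IH (foldl (fun a v => vand v a) a rows)) => //=.
  elim: (rows) (a) sz_v sz_a => //= v r IHr a0 /andP[/eqP sz_v sz_r] sz_a.
  by apply: IHr; rewrite // size_map size_zip sz_a sz_v minnn.
- pointwise; rewrite /= ?foldl_cat //; last 1 first.
    by rewrite big_cons catA /ones -nseqD addnC.
  + by rewrite !catrevE !rev_cat !catA.
  by rewrite !catrevE !rev_cat !catA.
rewrite /= s_e size_nseq sz_rows mulSn; lia.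
Qed.

(** * Choosing the coordinates and writing the kernel *)

Definition choose_columns :=
  Loop rA (fun a => if a then Case rF (fun o => Push rX (o != None))
                    else Push rX false) ;;
  Loop rF (fun _ => Push rBad true).

Lemma run_choose_columns a f s : s rA = a -> s rF = ones f ->
  run choose_columns s (4 * size a + 3 * f + 2)
    (upd (upd (upd (upd s rA [::]) rF [::]) rX (catrev (drops id f a) (s rX)))
      rBad (ones (f - count id a) ++ s rBad)).
Proof.
move=> s_a s_f.
have loop a0 f0 s0 : s0 rA = a0 -> s0 rF = ones f0 ->
    run (Loop rA (fun a => if a then Case rF (fun o => Push rX (o != None))
                    else Push rX false)) s0 (4 * size a0 + 1)
      (upd (upd (upd s0 rA [::]) rF (ones (f0 - count id a0)))
        rX (catrev (drops id f0 a0) (s0 rX))).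
  elim: a0 f0 s0 => [|[] a0 IH] {s_a s_f}f {}s s_a s_f.
  - eapply runs_weak; first exact: runs_loop_nil.
      by pointwise; rewrite /= ?subn0.
    by [].
  - eapply runs_weak.
    + apply: (runs_loop_cons _ s_a) => //.
        by apply: runs_case => //; exact: runs_push.
      by apply: (IH (f - 1)); rewrite //= s_f; case: (f) => //= ?; rewrite subn1.
    + by pointwise; rewrite /= ?subnDA // s_f; case: (f).
    by rewrite /=; lia.
  eapply runs_weak.
  + apply: (runs_loop_cons _ s_a) => //; first exact: runs_push.
    by apply: (IH f).
  + by pointwise; rewrite /= ?subn0.
  by rewrite /=; lia.
eapply runs_weak.
- rewrite /choose_columns; eapply runs_seq; first exact: (loop a f).
  exact: run_flush.
- by pointwise.
lia.
Qed.

Definition kept (x : seq bool) (r : bool) (v : seq bool) :=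
  if r then [::] else mask (map negb x) v.

Definition write_data :=
  Loop rR (fun r =>
    Loop rUP (fun _ => Push rUP' true ;; Case rDat' (fun o => if o is Some b then
      Case rX (fun o => if o is Some x then
         Push rX' x ;; (if x || r then Skip else Push rDat b) else Skip)
      else Skip)) ;;
    move_to rX' rX ;; move_to rUP' rUP).

Lemma run_write_row (r : bool) v d x s : size x = size v ->
  s rUP = ones (size v) -> s rDat' = v ++ d -> s rX = x -> s rX' = [::] ->
  s rUP' = [::] ->
  run (Loop rUP (fun _ => Push rUP' true ;; Case rDat' (fun o => if o is Some b then
      Case rX (fun o => if o is Some x then
         Push rX' x ;; (if x || r then Skip else Push rDat b) else Skip)
      else Skip)) ;;
    move_to rX' rX ;; move_to rUP' rUP) s (15 * size v + 3)
    (upd (upd s rDat' d) rDat (catrev (kept x r v) (s rDat))).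
Proof.
move=> sz s_p s_d s_x s_x' s_p'.
have emit (c b : bool) s0 : run (if c then Skip else Push rDat b) s0 2
    (upd s0 rDat (if c then s0 rDat else b :: s0 rDat)).
  case: c; last exact: runs_push.
  by eapply runs_weak; [exact: runs_skip | pointwise |].
have loop x0 v0 s0 : size x0 = size v0 -> s0 rUP = ones (size v0) ->
    s0 rDat' = v0 ++ d -> s0 rX = x0 ->
    run (Loop rUP (fun _ => Push rUP' true ;; Case rDat' (fun o => if o is Some b then
      Case rX (fun o => if o is Some x then
         Push rX' x ;; (if x || r then Skip else Push rDat b) else Skip)
      else Skip))) s0 (9 * size v0 + 1)
      (upd (upd (upd (upd (upd (upd s0 rUP [::]) rDat' d)
         rX [::]) rX' (catrev x0 (s0 rX'))) rUP' (catrev (ones (size v0)) (s0 rUP')))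
         rDat (catrev (kept x0 r v0) (s0 rDat))).
  elim: v0 x0 s0 => [|b v0 IH] [|x1 x0] //= {sz s_p s_d s_x s_x' s_p'}s.
    move=> _ s_p s_d s_x; eapply runs_weak; first exact: runs_loop_nil.
      by pointwise; rewrite /= /kept; case: (r).
    by [].
  move=> [sz] s_p s_d s_x; eapply runs_weak.
  - apply: (runs_loop_cons _ s_p) => //.
      eapply runs_seq; first exact: runs_push.
      apply: runs_case => //; rewrite /= s_d /=.
      apply: runs_case => //; rewrite /= s_x /=.
      by eapply runs_seq; [exact: runs_push | exact: emit].
    exact: (IH x0).
  - by pointwise; rewrite /= /kept; case: (r); case: (x1).
  rewrite /=; lia.
eapply runs_weak.
- eapply runs_seq; first exact: (loop x v).
  by eapply runs_seq; apply: run_move.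
- by pointwise; rewrite /= ?s_x' ?s_p' ?s_p ?(catrev_ones _ 0)
     -?/(rev x) ?catrevE ?cats0 ?revK ?addn0.
by rewrite /= s_x' s_p' (catrev_ones _ 0) -/(rev x) size_rev size_nseq sz; lia.
Qed.

Lemma run_write_data p (L : seq (bool * seq bool)) x s :
  all (fun rv => size rv.2 == p) L -> size x = p ->
  s rUP = ones p -> s rR = map fst L -> s rDat' = flatten (map snd L) ->
  s rX = x -> s rX' = [::] -> s rUP' = [::] ->
  run write_data s (size L * (15 * p + 4) + 1)
    (upd (upd (upd s rR [::]) rDat' [::])
      rDat (flatten (rev [seq rev (kept x rv.1 rv.2) | rv <- L]) ++ s rDat)).
Proof.
move=> szL sz_x; elim: L s szL => [|[r v] L IH] s /=.
  move=> _ s_p s_r s_d s_x s_x' s_p'; eapply runs_weak.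
  - exact: runs_loop_nil.
  - by pointwise.
  by [].
move=> /andP[/eqP sz_v szL] s_p s_r s_d s_x s_x' s_p'; eapply runs_weak.
- apply: (runs_loop_cons _ s_r) => //.
    by apply: (@run_write_row r v (flatten (map snd L)) x); rewrite /= ?sz_v.
  exact: IH.
- by pointwise; rewrite /= rev_cons flatten_rcons catrevE catA.
rewrite sz_v /=; lia.
Qed.

Definition emit h :=
  Push rDat false ;; Loop h (fun b => Push rDat b ;; Push rDat true).

(** On a stack a code is built from its end: the delimiter, then the digits from the most
    significant one, each followed by its 1. *)
Lemma run_emit h x s : 0 < h < 25 -> s h = rev (binary x) ->
  run (emit h) s (5 * size (binary x) + 3)
    (upd (upd s h [::]) rDat (encode_nat x ++ s rDat)).
Proof.
move=> /andP[h_gt0 lt_h] s_h.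
have h_ne0 : (h == 0) = false by rewrite eqn0Ngt h_gt0.
have loop w s0 : s0 h = w ->
    run (Loop h (fun b => Push rDat b ;; Push rDat true)) s0 (5 * size w + 1)
      (upd (upd s0 h [::]) rDat
         (flatten [seq [:: true; b] | b <- rev w] ++ s0 rDat)).
  elim: w s0 => [|b w IH] {s_h}s s_h.
    eapply runs_weak; first exact: runs_loop_nil.
      by move=> k; rewrite !updE; case: eqP => [->//|_]; case: eqP => [->|].
    by [].
  eapply runs_weak.
  - apply: (runs_loop_cons _ s_h) => //.
      by eapply runs_seq; exact: runs_push.
    by apply: IH; rewrite !updE h_ne0 eqxx.
  - move=> k; rewrite !updE ?(eq_sym 0 h) h_ne0 eqxx.
    case: eqP => _; last by case: eqP.
    by rewrite rev_cons map_rcons flatten_rcons -!catA.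
  rewrite /=; lia.
eapply runs_weak.
- rewrite /emit; eapply runs_seq; first exact: runs_push.
  by apply: loop; rewrite updE h_ne0; exact: s_h.
- move=> k; rewrite !updE eqxx.
  case: eqP => _; last by case: eqP.
  by rewrite revK /encode_nat -catA.
by rewrite size_rev; lia.
Qed.

(** * Treatment of the header and choice of the output *)

Definition prepare :=
  parse rM ;; parse rN ;; parse rP ;; parse rK ;;
  Case rDat (fun o => if o is Some b then Push rDat b else Push rZ true) ;;
  unary rN rUN ;; unary rP rUP ;; unary rK rUK ;;
  subtract rUN rUK rE ;; subtract rUP rUK rF ;;
  clamp rE rN ;; clamp rF rP ;; copy rUP rA.

Definition prepared (m n p k : nat) (d : seq bool) : state :=
  let c := size d in
  let e := minn c n - minn c k in
  let f := minn c p - minn c k in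
  upd (upd (upd (upd (upd (upd (upd (upd (upd (upd (upd (upd (fun=> [::])
    rDat d) rM (rev (binary m)))
    rN (rev (binary (if e == 0 then n else k))))
    rP (rev (binary (if f == 0 then p else k))))
    rK (rev (binary k)))
    rUN (ones (minn c n))) rUP (ones (minn c p))) rUK (ones (minn c k)))
    rE (ones e)) rF (ones f)) rA (ones (minn c p))) rZ (ones (c == 0)).

Lemma size_encode_nat x : size (encode_nat x) = 2 * size (binary x) + 1.
Proof.
rewrite /encode_nat size_cat size_flatten /shape -map_comp.
rewrite (@eq_map _ _ _ (fun=> 2)) // sumnE big_map big_const_seq count_predT.
by rewrite iter_addn_0 mulnC.
Qed.

Lemma run_prepare m n p k d w :
  w = encode_nat m ++ encode_nat n ++ encode_nat p ++ encode_nat k ++ d ->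
  run prepare (upd (fun=> [::]) 0 w) (66 * size w ^ 2 + 130 * size w + 50)
    (prepared m n p k d).
Proof.
move=> Ew; set c := size d.
pose e := minn c n - minn c k; pose f := minn c p - minn c k.
have ones_nil T i (x y : T) :
    (if ones i is [::] then x else y) = if i == 0 then x else y.
  by case: i.
have flag s : s rZ = [::] ->
    run (Case rDat (fun o => if o is Some b then Push rDat b else Push rZ true)) s 3
      (upd s rZ (ones (size (s rDat) == 0))).
  move=> s_z; case s_d: (s rDat) => [|b v]; eapply runs_weak.
  - by apply: runs_case => //; rewrite s_d; exact: runs_push.
  - by pointwise; rewrite /= ?s_z ?s_d.
  - by [].
  - by apply: runs_case => //; rewrite s_d; exact: runs_push.
  - by pointwise; rewrite /= ?s_z ?s_d.
  by [].
eapply runs_weak.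
- rewrite /prepare.
  eapply runs_seq; first by apply: (@run_parse _ m _ _ _ Ew).
  eapply runs_seq; first by apply: (@run_parse _ n).
  eapply runs_seq; first by apply: (@run_parse _ p).
  eapply runs_seq; first by apply: (@run_parse _ k).
  eapply runs_seq; first exact: flag.
  eapply runs_seq; first by apply: (@run_unary _ _ n).
  eapply runs_seq; first by apply: (@run_unary _ _ p).
  eapply runs_seq; first by apply: (@run_unary _ _ k).
  eapply runs_seq; first by apply: (@run_subtract _ _ (minn c n) (minn c k)).
  eapply runs_seq; first by apply: (@run_subtract _ _ (minn c p) (minn c k)).
  eapply runs_seq; first exact: run_clamp.
  eapply runs_seq; first exact: run_clamp.
  exact: run_copy.
- by rewrite /prepared -/c -/e -/f; pointwise; rewrite /= ?cats0 // ones_nil;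
    case: eqP.
rewrite /= -/c !size_rev !size_nseq.
have := size_encode_nat m; have := size_encode_nat n.
have := size_encode_nat p; have := size_encode_nat k.
have := congr1 size Ew; rewrite !size_cat -/c.
move: (size w) (size (encode_nat m)) (size (encode_nat n)) (size (encode_nat p))
  (size (encode_nat k)) (size (binary m)) (size (binary n)) (size (binary p))
  (size (binary k)) => L em en ep ek bm bn bp bk EL Ek Ep En Em.
(* Each of the three conversions to unary costs at most [22 * c + 16] per digit; this is the source
   of the coefficient 66 = 3 * 22. *)
have U b : b <= L -> b * (22 * c + 16) <= L * (22 * c + 16).
  by move=> ?; rewrite leq_mul2r orbC; lia.
have := U bn; have := U bp; have := U bk.
have Uc : L * (22 * c + 16) <= 22 * L ^ 2 + 16 * L.
  have : L * c <= L * L by rewrite leq_mul //; lia.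
  rewrite expnS expn1; lia.
lia.
Qed.

Fixpoint push_word (w : seq bool) :=
  if w is b :: w' then push_word w' ;; Push rDat b else Skip.

Arguments push_word : simpl never.

Lemma run_push_word w s :
  run (push_word w) s (2 * size w + 1) (upd s rDat (w ++ s rDat)).
Proof.
elim: w s => [|b w IH] s.
  by eapply runs_weak; [exact: runs_skip | pointwise |].
eapply runs_weak; first by eapply runs_seq; [exact: IH | exact: runs_push].
  by pointwise.
rewrite /=; lia.
Qed.

(** This word and the next are the codes of [trivial_yes] (all numbers 0) and [trivial_no] (a single
    zero bit with budget 0). *)
Definition yes_word := [:: false; false; false; false].
Definition no_word :=
  encode_nat 1 ++ encode_nat 1 ++ encode_nat 1 ++ encode_nat 0 ++ [:: false].

Definition finish :=
  Case rZ (fun o => if o is Some _ then drain rDat ;; push_word yes_word else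
  Case rBad (fun o => if o is Some _ then drain rDat ;; push_word no_word else
  Case rK (fun o =>
    if o is Some b then Push rK b ;; emit rK ;; emit rP ;; emit rN ;; emit rM
    else drain rDat ;; push_word yes_word))).

Lemma run_finish m n p k (z : bool) bad s :
  s rM = rev (binary m) -> s rN = rev (binary n) -> s rP = rev (binary p) ->
  s rK = rev (binary k) -> s rZ = ones z -> s rBad = ones bad ->
  exists s', run finish s (2 * size (s rDat) + 5 * (size (binary m) +
      size (binary n) + size (binary p) + size (binary k)) + 40) s' /\
    s' rDat = if z then yes_word else if 0 < bad then no_word else
      if k == 0 then yes_word else
      encode_nat m ++ encode_nat n ++ encode_nat p ++ encode_nat k ++ s rDat.
Proof.
move=> s_m s_n s_p s_k s_z s_b.
case: z s_z => s_z.
  eexists; split.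
    eapply runs_weak.
    - apply: runs_case => //; rewrite s_z /=.
      by eapply runs_seq; [exact: run_drain | exact: run_push_word].
    - by move=> ?; reflexivity.
    rewrite /=; lia.
  by [].
case: bad s_b => [|bad] s_b; last first.
  eexists; split.
    eapply runs_weak.
    - apply: runs_case => //; rewrite s_z /=; apply: runs_case => //; rewrite /= s_b /=.
      by eapply runs_seq; [exact: run_drain | exact: run_push_word].
    - by move=> ?; reflexivity.
    rewrite /=; lia.
  by [].
case: eqP => k0.
  have b_k : s rK = [::] by rewrite s_k k0.
  eexists; split.
    eapply runs_weak.
    - apply: runs_case => //; rewrite s_z /=; apply: runs_case => //; rewrite /= s_b /=.
      apply: runs_case => //; rewrite /= b_k /=.
      by eapply runs_seq; [exact: run_drain | exact: run_push_word].
    - by move=> ?; reflexivity.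
    rewrite /=; lia.
  by [].
case b_k: (s rK) => [|b v].
  by case: k0; apply: binary_nil; rewrite -[LHS]revK -s_k b_k.
eexists; split.
  eapply runs_weak.
  - apply: runs_case => //; rewrite s_z /=; apply: runs_case => //; rewrite /= s_b /=.
    apply: runs_case => //; rewrite /= b_k /=.
    eapply runs_seq; first exact: runs_push.
    eapply runs_seq; first by apply: (@run_emit _ k); rewrite //= -s_k b_k.
    eapply runs_seq; first by apply: (@run_emit _ p).
    eapply runs_seq; first by apply: (@run_emit _ n).
    by apply: (@run_emit _ m).
  - by move=> ?; reflexivity.
  lia.
by rewrite /=.
Qed.

(** * The complete program and its running time *)

Definition reduce_rows e x (rows : seq (seq bool)) :=
  [seq mask (map negb x) v | v <- mask (map negb (drops (all id) e rows)) rows].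

Lemma size_drops T (P : pred T) e s : size (drops P e s) = size s.
Proof. by elim: s e => //= x s IH e; rewrite IH. Qed.

Lemma size_foldl_vand p rows a : size a = p ->
  all (fun v => size v == p) rows -> size (foldl (fun a v => vand v a) a rows) = p.
Proof.
elim: rows a => //= v rows IH a sz_a /andP[/eqP sz_v /IH]; apply.
by rewrite size_map size_zip sz_a sz_v minnn.
Qed.

(** The program handles the vectors as one stream with a flag each; the kernel is described set by
    set. *)
Lemma flatten_kept e x (V : seq (seq (seq bool))) :
  flatten [seq kept x rv.1 rv.2 | rv <-
    zip (flatten [seq drops (all id) e rows | rows <- V]) (flatten V)] =
  flatten (flatten [seq reduce_rows e x rows | rows <- V]).
Proof.
elim: V => //= rows V IH; rewrite zip_cat ?size_drops // map_cat !flatten_cat IH.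
congr (_ ++ _); rewrite /reduce_rows; elim: rows e {IH} => //= v rows IH e.
by rewrite IH /kept; case: (all id v && (0 < e)).
Qed.

Lemma flatten_rev (T : Type) (s : seq (seq T)) :
  rev (flatten s) = flatten (map rev (rev s)).
Proof. by elim: s => //= v s IH; rewrite rev_cat IH rev_cons map_rcons flatten_rcons. Qed.

Lemma mem_zip_snd (T1 T2 : eqType) (s : seq T1) (t : seq T2) x y :
  (x, y) \in zip s t -> y \in t.
Proof.
elim: s t => [|x1 s IH] [|y1 t] //=; rewrite !inE => /orP[/eqP[_ ->]|/IH->].
  by rewrite eqxx.
by rewrite orbT.
Qed.

Definition program :=
  prepare ;; read_data ;; choose_columns ;; write_data ;; finish.

Definition column_ands p (rows : seq (seq bool)) :=
  foldl (fun a v => vand v a) (ones p) rows.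

(** It vanishes exactly when [f] coordinates and, in every set, [e] all-ones vectors are available
    for dropping. *)
Definition deficit (e f : nat) (a : seq bool) (V : seq (seq (seq bool))) :=
  (f - count id a) + \sum_(rows <- V) (e - count (all id) rows).

Lemma cost_arith M n p e f c o b W :
  M <= c -> M * n <= c -> M * e <= c -> f <= c -> p <= c -> M * n * p = c ->
  o <= c -> c <= W -> b <= 2 * W ->
  (66 * W ^ 2 + 130 * W + 50) + ((M * (n * (18 * p + 15) + 11 * e + 8) + 1) +
  ((4 * p + 3 * f + 2) + ((M * n * (15 * p + 4) + 1) + (2 * o + 5 * b + 40))))
  <= 1000 * W ^ 2 + 1000.
Proof.
move=> le_M le_N le_e le_f le_p E le_o le_c le_b.
have -> : M * (n * (18 * p + 15) + 11 * e + 8) =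
  18 * (M * n * p) + 15 * (M * n) + 11 * (M * e) + 8 * M by lia.
have -> : M * n * (15 * p + 4) = 15 * (M * n * p) + 4 * (M * n) by lia.
have : W <= W ^ 2 by rewrite expnS expn1; case: (W) => // ?; rewrite leq_pmulr.
rewrite E; lia.
Qed.

(** The sizes are the capped ones [n'] and [p'], equal to [n] and [p] once there is data. This form
    also covers empty data, with [V] empty. *)
Lemma run_program m n p k (V : seq (seq (seq bool))) w :
  let d := flatten (flatten V) in
  let n' := minn (size d) n in let p' := minn (size d) p in
  let e := n' - minn (size d) k in let f := p' - minn (size d) k in
  let a := column_ands p' (flatten V) in
  w = encode_nat m ++ encode_nat n ++ encode_nat p ++ encode_nat k ++ d ->
  all (fun rows => flatten rows != [::]) V -> all (fun rows => size rows == n') V ->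
  all (fun v => size v == p') (flatten V) ->
  exists s, run program (upd (fun=> [::]) 0 w) (1000 * size w ^ 2 + 1000) s /\
    s 0 = if d == [::] then yes_word else if 0 < deficit e f a V then no_word else
      if k == 0 then yes_word else
      encode_nat m ++ encode_nat (if e == 0 then n else k) ++
      encode_nat (if f == 0 then p else k) ++ encode_nat k ++
      flatten (flatten [seq reduce_rows e (drops id f a) rows | rows <- V]).
Proof.
move=> d n' p' e f a Ew ne_V szV szv.
have sz_a : size a = p' by apply: size_foldl_vand; rewrite ?size_nseq.
pose flags := flatten [seq drops (all id) e rows | rows <- V].
have sz_flags : size flags = size (flatten V).
  by rewrite /flags; elim: (V) => //= rows U IH; rewrite !size_cat IH size_drops.
pose x := drops id f a.
(* The vectors and their flags as [write_data] meets them: from the last to the first, each one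
   reversed. *)
pose L := rev [seq (rv.1, rev rv.2) | rv <- zip flags (flatten V)].
have L1 : map fst L = rev flags.
  rewrite map_rev -map_comp (eq_map (g := fst)) //.
  by rewrite -/(unzip1 _) unzip1_zip ?sz_flags.
have L2 : flatten (map snd L) = rev d.
  rewrite /d flatten_rev /L !map_rev -map_comp (eq_map (g := rev \o snd)) //.
  by rewrite map_comp -/(unzip2 _) unzip2_zip ?sz_flags.
have szL : all (fun rv => size rv.2 == p') L.
  rewrite all_rev all_map; apply/allP=> -[r v] /mem_zip_snd v_in /=.
  by rewrite size_rev; exact: (allP szv).
pose s1 := upd (upd (upd (upd (prepared m n p k d)
  rDat [::]) rDat' (rev d)) rA a) rR (rev flags).
pose bad1 := \sum_(rows <- V) (e - count (all id) rows).
pose s2 := upd s1 rBad (ones bad1).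
pose s3 := upd (upd (upd (upd s2 rA [::]) rF [::]) rX (rev x))
   rBad (ones (deficit e f a V)).
pose s4 := upd (upd (upd s3 rR [::]) rDat' [::])
   rDat (flatten (flatten [seq reduce_rows e x rows | rows <- V])).
have [s' [R5 E5]] := @run_finish m (if e == 0 then n else k) (if f == 0 then p else k)
  k (size d == 0) (deficit e f a V) s4 erefl erefl erefl erefl erefl erefl.
exists s'; split; last by rewrite E5 size_eq0.
have R2 : run read_data (prepared m n p k d)
    (size V * (n' * (18 * p' + 15) + 11 * e + 8) + 1) s2.
  eapply runs_weak.
  - by apply: (@run_read_data n' p' e V (ones p')); rewrite ?size_nseq.
  - by pointwise; rewrite /= ?cats0.
  by [].
have R3 : run choose_columns s2 (4 * p' + 3 * f + 2) s3.
  eapply runs_weak.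
  - by apply: (@run_choose_columns a f).
  - by pointwise; rewrite /s3 /s2 /= /deficit /ones nseqD.
  by rewrite sz_a.
have R4 : run write_data s3 (size L * (15 * p' + 4) + 1) s4.
  eapply runs_weak.
  - by apply: (@run_write_data p' L (rev x)); rewrite ?size_rev ?size_drops.
  - pointwise; rewrite /s4 /= cats0 -flatten_kept -map_rev revK -map_comp.
    congr flatten; apply/eq_in_map=> -[r v] /mem_zip_snd v_in /=; rewrite /kept.
    case: r => //; rewrite map_rev -rev_mask ?revK // size_map size_drops sz_a.
    by rewrite (eqP (allP szv _ v_in)).
  by [].
eapply runs_weak.
- rewrite /program; eapply runs_seq; first exact: run_prepare Ew.
  eapply runs_seq; first exact: R2.
  eapply runs_seq; first exact: R3.
  by eapply runs_seq; [exact: R4 | exact: R5].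
- by [].
have sz_d : size (flatten V) * p' = size d.
  rewrite /d (size_flatten (flatten V)) sumnE big_map mulnC.
  by rewrite (eq_big_seq (fun=> p')) ?big_const_seq ?count_predT ?iter_addn_0
             // => v /(allP szv)/eqP.
have sz_V : size V * n' = size (flatten V).
  rewrite (size_flatten V) sumnE big_map mulnC.
  by rewrite (eq_big_seq (fun=> n')) ?big_const_seq ?count_predT ?iter_addn_0
             // => v /(allP szV)/eqP.
have pos_d : (0 < size V) -> (0 < size d).
  rewrite /d; case: (V) ne_V => //= rows U /andP[ne_rows _] _.
  by rewrite flatten_cat size_cat addn_gt0 lt0n size_eq0 ne_rows.
have sz_out : size (flatten (flatten [seq reduce_rows e x rows | rows <- V])) <= size d.
  rewrite -flatten_kept /d -/flags; elim: (flags) (flatten V) => [|r fs IH] [|v vs] //=.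
  rewrite !size_cat leq_add ?IH // /kept; case: r => //.
  by rewrite size_subseq ?mask_subseq.
have [le_V le_N le_e] :
    [/\ size V <= size d, size V * n' <= size d & size V * e <= size d].
  have le_e : size V * e <= size V * n' by rewrite leq_mul2l leq_subr orbT.
  case: (posnP (size V)) => [->|V_gt0]; first by [].
  have := pos_d V_gt0; rewrite -sz_V in sz_d; rewrite -sz_d !muln_gt0.
  move=> /andP[/andP[_ n_gt0] p_gt0].
  have le1 : size V * n' <= size V * n' * p' by rewrite leq_pmulr.
  have le2 : size V <= size V * n' by rewrite leq_pmulr.
  by split=> //; [exact: leq_trans le1 | exact: leq_trans le1].
have := congr1 size Ew; do 4 rewrite size_cat size_encode_nat.
have le_f : f <= size d by rewrite /f /p'; lia.
have le_p : p' <= size d by rewrite /p'; lia.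
have sz_L : size L = size V * n' by rewrite size_rev size_map size_zip sz_flags minnn.
have out_d : size (s4 rDat) <= size d by [].
have hdr (b : bool) y z : size (binary (if b then y else z)) <=
    size (binary y) + size (binary z) by case: b; lia.
have := hdr (e == 0) n k; have := hdr (f == 0) p k.
rewrite sz_L -sz_V in sz_d *; move=> hdr_p hdr_n Esz.
by apply: (cost_arith le_V le_N le_e le_f le_p sz_d out_d); lia.
Qed.

(** * Correctness of the reductions *)

Section Assignments.

Implicit Types (V W : nat -> seq (seq bool)).

Definition stack_bit m W a r :=
  all (fun i => nth true (nth [::] (W i) a) r) (iota 0 m).

Definition stack_cost m p W a := \sum_(r <- iota 0 p) ~~ stack_bit m W a r.

Definition cost m n p W := \sum_(a <- iota 0 n) stack_cost m p W a.

(** A solution is a rearrangement [W i] of each list [V i], stack [a] consisting of the vectors at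
    position [a]. Disjointness is thus built in. *)
Definition assignable m n p k V :=
  exists W, (forall i, i < m -> perm_eq (W i) (V i)) /\ cost m n p W <= k.

Definition wf m n p V :=
  forall i, i < m -> size (V i) = n /\ all (fun v => size v == p) (V i).

Lemma wf_perm m n p V W :
  (forall i, i < m -> perm_eq (W i) (V i)) -> wf m n p V -> wf m n p W.
Proof.
move=> perm_W wfV i lt_i; have [sz_V szs_V] := wfV i lt_i.
by rewrite (perm_size (perm_W i lt_i)) (perm_all _ (perm_W i lt_i)).
Qed.

Lemma all_id_ones (v : seq bool) : all id v = (v == ones (size v)).
Proof. by elim: v => //= b v ->; case: b. Qed.

Lemma wf_nth m n p V i a :
  wf m n p V -> i < m -> a < n -> size (nth [::] (V i) a) = p.
Proof.
move=> wfV lt_i lt_a; have [sz_V /allP szs_V] := wfV i lt_i.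
by apply/eqP/szs_V/mem_nth; rewrite sz_V.
Qed.

Lemma stack_cost_eq0 m n p W a i : wf m n p W -> a < n -> stack_cost m p W a = 0 ->
  i < m -> nth [::] (W i) a = ones p.
Proof.
move=> wfW lt_a /eqP; rewrite /stack_cost sum_nat_seq_eq0 => /allP free lt_i.
have sz_a := wf_nth wfW lt_i lt_a.
apply: (@eq_from_nth _ true); rewrite ?size_nseq // sz_a => r lt_r.
have := free r; rewrite mem_iota add0n lt_r eqb0 negbK => /(_ isT) /allP/(_ i).
by rewrite mem_iota add0n lt_i nth_nseq lt_r => ->.
Qed.

Lemma free_stacks m n p k W : cost m n p W <= k ->
  n - k <= count (fun a => stack_cost m p W a == 0) (iota 0 n).
Proof.
move=> le_k; have := count_predC (fun a => stack_cost m p W a == 0) (iota 0 n).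
rewrite size_iota; set c := count (predC _) _.
suff: c <= cost m n p W by lia.
rewrite /c -sum1_count big_mkcond /=; apply: leq_sum => a _.
by case: (stack_cost m p W a).
Qed.

Lemma stack_cost_ext m p W W' a b :
  (forall i, i < m -> nth [::] (W i) a = nth [::] (W' i) b) ->
  stack_cost m p W a = stack_cost m p W' b.
Proof.
move=> E; apply: eq_bigr => r _; congr (nat_of_bool (~~ _)).
by apply: eq_in_all => i; rewrite mem_iota => /andP[_ lt_i]; rewrite E.
Qed.

(* The free stacks of a solution may be taken to be the ones that use the     *)
(* dropped vectors, since all vectors involved are equal.                     *)
Lemma assignable_rows m n p k e V V' :
  wf m n p V -> e <= n -> e <= n - k ->
  (forall i, i < m -> perm_eq (V i) (nseq e (ones p) ++ V' i)) ->
  assignable m n p k V <-> assignable m (n - e) p k V'.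
Proof.
move=> wfV le_e_n le_e perm_V; split=> [[W [perm_W le_k]]|[W' [perm_W' le_k]]].
  have wfW := wf_perm perm_W wfV.
  (* [d] lists [e] free stacks to be removed; [rest] lists the stacks that remain. *)
  pose zs := [seq a <- iota 0 n | stack_cost m p W a == 0].
  pose d := take e zs; pose rest := [seq a <- iota 0 n | a \notin d].
  have sz_d : size d = e.
    by rewrite size_takel // size_filter (leq_trans le_e) ?free_stacks.
  have d_zs a : a \in d -> (a < n) && (stack_cost m p W a == 0).
    by move=> /mem_take; rewrite mem_filter mem_iota add0n andbC.
  have perm_iota : perm_eq (iota 0 n) (d ++ rest).
    rewrite perm_sym (perm_trans _ (permEl (perm_filterC (mem d) _))) //.
    rewrite perm_cat2r; apply: uniq_perm.
    - by rewrite take_uniq ?filter_uniq ?iota_uniq.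
    - by rewrite filter_uniq ?iota_uniq.
    move=> a; rewrite mem_filter mem_iota add0n inE.
    by case: (boolP (a \in d)) => // /d_zs/andP[->].
  have sz_rest : size rest = n - e.
    by have := perm_size perm_iota; rewrite size_iota size_cat sz_d => ->; lia.
  exists (fun i => [seq nth [::] (W i) a | a <- rest]); split=> [i lt_i|].
    rewrite -(perm_cat2l (nseq e (ones p))) -(permPr (perm_V i lt_i)).
    rewrite -(permPr (perm_W i lt_i)).
    have <- : [seq nth [::] (W i) a | a <- d] = nseq e (ones p).
      rewrite -sz_d; have : {in d, forall a, nth [::] (W i) a = ones p}.
        by move=> a /d_zs/andP[lt_a /eqP /(stack_cost_eq0 wfW lt_a)]; apply.
      elim: (d) => //= a s IH E; rewrite E ?mem_head ?IH // => b b_s.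
      by apply: E; rewrite inE b_s orbT.
    have [sz_W _] := wfW i lt_i.
    rewrite -map_cat -{2}(mkseq_nth [::] (W i)) sz_W perm_map //.
    by rewrite perm_sym.
  apply: leq_trans le_k; rewrite /cost (perm_big _ perm_iota) big_cat /=.
  rewrite -[leqLHS]add0n leq_add //.
  rewrite -[X in _ <= \sum_(a <- X) _](mkseq_nth 0 rest) sz_rest big_map.
  rewrite -(subn0 (n - e)) !big_nat; apply: leq_sum => a /andP[_ lt_a].
  rewrite (@stack_cost_ext m p _ W a (nth 0 rest a)) // => i lt_i.
  by rewrite (nth_map 0) ?sz_rest.
exists (fun i => nseq e (ones p) ++ W' i); split=> [i lt_i|].
  by rewrite (permPr (perm_V i lt_i)) perm_cat2l perm_W'.
rewrite /cost -{1}(subnKC le_e_n) iotaD big_cat /= add0n.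
(* The [e] stacks added in front are made of all-ones vectors and cost nothing. *)
rewrite big1_seq => [|a /andP[_]]; last first.
  rewrite mem_iota add0n => /= lt_a; rewrite /stack_cost big1_seq // => r.
  rewrite mem_iota add0n => /= lt_r; apply/eqP; rewrite eqb0 negbK.
  by apply/allP => i _; rewrite nth_cat size_nseq lt_a nth_nseq lt_a nth_nseq lt_r.
rewrite add0n -[e in iota e _]addn0 iotaDl big_map.
apply: leq_trans le_k; apply: leq_sum => a _.
rewrite (@stack_cost_ext m p _ W' _ a) // => i lt_i.
by rewrite nth_cat size_nseq ltnNge leq_addr addKn.
Qed.

(** * Dropping constant coordinates *)

Definition proj (idx : seq nat) (v : seq bool) := [seq nth true v r | r <- idx].

Definition expand p (idx : seq nat) (w : seq bool) :=
  [seq if r \in idx then nth true w (index r idx) else true | r <- iota 0 p].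

Definition constant_outside m p (idx : seq nat) V :=
  forall i v r, i < m -> v \in V i -> r < p -> r \notin idx -> nth true v r.

Lemma projK p idx v : size v = p ->
  (forall r, r < p -> r \notin idx -> nth true v r) ->
  expand p idx (proj idx v) = v.
Proof.
move=> sz_v v_out; apply: (@eq_from_nth _ true); rewrite size_map size_iota //.
move=> r lt_r; rewrite (nth_map 0) ?size_iota // nth_iota // add0n.
case: ifPn => r_idx; last by rewrite v_out.
by rewrite (nth_map 0) ?index_mem // nth_index.
Qed.

Lemma cost_proj m n p idx W :
  wf m n p W -> uniq idx -> all (fun r => r < p) idx -> constant_outside m p idx W ->
  cost m n (size idx) (fun i => map (proj idx) (W i)) = cost m n p W.
Proof.
move=> wfW uniq_idx /allP lt_idx W_out; apply: eq_big_seq => a.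
rewrite mem_iota add0n => /= lt_a.
have perm_idx : perm_eq idx [seq r <- iota 0 p | r \in idx].
  apply: uniq_perm => //; first by rewrite filter_uniq ?iota_uniq.
  move=> r; rewrite mem_filter mem_iota add0n.
  by case: (boolP (r \in idx)) => // /lt_idx.
have sz_W i : i < m -> a < size (W i) by move=> /wfW[->].
transitivity (\sum_(r <- idx) ~~ stack_bit m W a r).
  rewrite -[X in _ = \sum_(r <- X) _](mkseq_nth 0 idx) big_map.
  apply: eq_big_seq => r; rewrite mem_iota add0n => /= lt_r.
  congr (nat_of_bool (~~ _)); apply: eq_in_all => i.
  rewrite mem_iota => /andP[_ lt_i].
  by rewrite (nth_map [::]) ?sz_W // (nth_map 0).
rewrite (perm_big _ perm_idx) big_filter big_mkcond.
apply: eq_big_seq => r; rewrite mem_iota add0n => /= lt_r.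
case: ifPn => // r_idx; symmetry; apply/eqP; rewrite eqb0 negbK.
apply/allP => i; rewrite mem_iota => /andP[_ lt_i].
by apply: (W_out i) => //; rewrite mem_nth ?sz_W.
Qed.

(** On the vectors of [V], [expand] inverts [proj], so it lifts rearrangements of the projected
    lists back; the dropped coordinates are 1 in every stack and do not affect the cost. *)
Lemma assignable_columns m n p k idx V :
  wf m n p V -> uniq idx -> all (fun r => r < p) idx -> constant_outside m p idx V ->
  assignable m n p k V <->
  assignable m n (size idx) k (fun i => map (proj idx) (V i)).
Proof.
move=> wfV uniq_idx lt_idx V_out.
have perm_out W : (forall i, i < m -> perm_eq (W i) (V i)) ->
    constant_outside m p idx W.
  by move=> perm_W i v r lt_i; rewrite (perm_mem (perm_W i lt_i)); apply: V_out.
split=> [[W [perm_W le_k]]|[W' [perm_W' le_k]]].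
  exists (fun i => map (proj idx) (W i)); split=> [i lt_i|].
    exact/perm_map/perm_W.
  by rewrite (@cost_proj _ _ p) //; [exact: wf_perm wfV | exact: perm_out].
pose W i := map (expand p idx) (W' i).
have VK i v : i < m -> v \in V i -> expand p idx (proj idx v) = v.
  move=> lt_i v_V; apply: projK => [|r lt_r]; last exact: V_out v_V lt_r.
  by have [_ /allP/(_ v v_V)/eqP] := wfV i lt_i.
have perm_W i : i < m -> perm_eq (W i) (V i).
  move=> lt_i; have := perm_map (expand p idx) (perm_W' i lt_i).
  suff -> : map (expand p idx) (map (proj idx) (V i)) = V i by [].
  by rewrite -map_comp -[RHS]map_id; apply/eq_in_map => v /(VK i v lt_i).
exists W; split=> //; apply: leq_trans le_k.
rewrite -(@cost_proj _ _ p idx) //; last 2 first.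
- exact: wf_perm wfV.
- exact: perm_out.
apply: eq_leq; apply: eq_bigr => a _; apply: stack_cost_ext => i lt_i.
rewrite -map_comp; congr nth; rewrite -[RHS]map_id; apply/eq_in_map => w.
rewrite (perm_mem (perm_W' i lt_i)) => /mapP[v v_V ->] /=.
by rewrite (VK i v lt_i v_V).
Qed.

(** * Necessary conditions for a cheap solution *)

Lemma assignable_ones m n p k V i : wf m n p V -> assignable m n p k V -> i < m ->
  n - k <= count (all id) (V i).
Proof.
move=> wfV [W [perm_W le_k]] lt_i; have wfW := wf_perm perm_W wfV.
rewrite -(permP (perm_W i lt_i)); have [sz_W _] := wfW i lt_i.
apply: leq_trans (free_stacks le_k) _.
rewrite -[in X in _ <= X](mkseq_nth [::] (W i)) sz_W /mkseq count_map.
rewrite (@eq_in_count _ _ (predI (fun a => stack_cost m p W a == 0)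
                                 (preim (nth [::] (W i)) (all id)))).
  by apply: sub_count => a /andP[].
move=> a; rewrite mem_iota add0n => /= lt_a; case: eqP => //= free.
by rewrite (stack_cost_eq0 wfW lt_a free lt_i) all_id_ones size_nseq eqxx.
Qed.

Lemma assignable_nonconstant m n p k V :
  wf m n p V -> assignable m n p k V ->
  p - k <= count (fun r => all (fun i => all (fun v => nth true v r) (V i)) (iota 0 m))
                 (iota 0 p).
Proof.
move=> wfV [W [perm_W le_k]]; have wfW := wf_perm perm_W wfV.
set good := fun r => _; have := count_predC good (iota 0 p); rewrite size_iota.
set c := count (predC _) _; suff: c <= cost m n p W by lia.
(* Summed by coordinates instead of stacks, the cost is at least 1 for each coordinate in which some
   vector has a zero. *)
rewrite /cost exchange_big /= /c -sum1_count big_mkcond /=.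
apply: leq_sum => r _; case: ifP => // /allPn[i]; rewrite mem_iota => /andP[_ lt_i].
rewrite -(perm_all _ (perm_W i lt_i)) => /allPn[v /(nthP [::])[a lt_a <-] bad].
have [sz_W _] := wfW i lt_i; rewrite sz_W in lt_a.
rewrite (bigD1_seq a) ?iota_uniq ?mem_iota ?add0n //=.
have -> // : stack_bit m W a r = false.
apply/negP => /allP/(_ i); rewrite mem_iota add0n lt_i => /(_ isT).
exact/negP.
Qed.

End Assignments.

(** * The kernel *)

Definition rows_of (I : instance) : seq (seq (seq bool)) :=
  [seq [seq tval (vec i j) | j <- enum 'I_(dim_n I)] | i <- enum 'I_(dim_m I)].

Definition of_rows m n p k (V : seq (seq (seq bool))) : instance :=
  @Instance m n p k (fun i j =>
    [tuple nth true (nth [::] (nth [::] V i) j) r | r < p]).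

Lemma nth_rows_of (I : instance) (i : 'I_(dim_m I)) :
  nth [::] (rows_of I) i = [seq tval (vec i j) | j <- enum 'I_(dim_n I)].
Proof. by rewrite (nth_map i) ?size_enum_ord // nth_ord_enum. Qed.

Lemma size_rows_of (I : instance) : size (rows_of I) = dim_m I.
Proof. by rewrite size_map size_enum_ord. Qed.

Lemma wf_rows_of (I : instance) :
  wf (dim_m I) (dim_n I) (dim_p I) (nth [::] (rows_of I)).
Proof.
move=> i lt_i; rewrite (nth_rows_of (Ordinal lt_i)) size_map size_enum_ord.
by split=> //; rewrite all_map; apply/allP => j _ /=; rewrite size_tuple.
Qed.

Lemma rows_ofK m n p k V : size V = m -> wf m n p (nth [::] V) ->
  rows_of (of_rows m n p k V) = V.
Proof.
move=> sz_V wfV; apply: (@eq_from_nth _ [::]).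
  by rewrite size_map size_enum_ord sz_V.
move=> i; rewrite size_map size_enum_ord => lt_i.
have [sz_i szs_i] := wfV i lt_i.
rewrite (nth_rows_of (I := of_rows m n p k V) (Ordinal lt_i)) /=.
apply: (@eq_from_nth _ [::]); first by rewrite size_map size_enum_ord sz_i.
move=> j; rewrite size_map size_enum_ord => lt_j.
rewrite (nth_map (Ordinal lt_j)) ?size_enum_ord //= nth_enum_ord //.
rewrite -[RHS](mkseq_nth true) (wf_nth wfV lt_i lt_j) /mkseq -val_enum_ord -map_comp.
exact: eq_map.
Qed.

Lemma big_iota_ord (R : Type) (idx : R) (op : Monoid.law idx) n (F : nat -> R) :
  \big[op/idx]_(i <- iota 0 n) F i = \big[op/idx]_(i < n) F i.
Proof. by rewrite -[X in iota _ X]subn0 big_mkord. Qed.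

Lemma cost_solution (I : instance) (S : 'I_(dim_n I) -> stack I)
    (W : nat -> seq (seq bool)) :
  (forall (i : 'I_(dim_m I)) (a : 'I_(dim_n I)),
     nth [::] (W i) a = vec i (S a i)) ->
  cost (dim_m I) (dim_n I) (dim_p I) W = solution_cost S.
Proof.
move=> WE; rewrite /cost big_iota_ord; apply: eq_bigr => a _.
rewrite /stack_cost /vector_cost big_iota_ord.
set v := stack_vector _; apply: (@addIn (\sum_(r < dim_p I) nat_of_bool (tnth v r))).
rewrite subnK; last first.
  rewrite -[leqRHS]card_ord -sum1_card; apply: leq_sum => r _.
  by case: (tnth _ r).
rewrite -big_split /= -[RHS]card_ord -sum1_card; apply: eq_bigr => r _.
have -> : stack_bit (dim_m I) W a r = tnth v r.
  rewrite tnth_mktuple /stack_bit -big_all big_iota_ord; apply: eq_bigr => i _.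
  by rewrite WE -tnth_nth.
by case: (tnth v r).
Qed.

(** Disjointness makes the choice of indices in each V^i injective, hence a permutation. Conversely,
    equality of multisets yields a permutation of indices for each i, so that equal vectors are told
    apart. *)
Lemma bMVA_assignable (I : instance) :
  bMVA I <->
  assignable (dim_m I) (dim_n I) (dim_p I) (budget I) (nth [::] (rows_of I)).
Proof.
split=> [[S [solS le_k]]|[W [perm_W le_k]]].
  pose W i := if insub i is Some i'
    then [seq tval (vec i' (S a i')) | a <- enum 'I_(dim_n I)] else [::].
  exists W; split=> [i lt_i|].
    rewrite /W insubT (nth_rows_of (Ordinal lt_i)) /=; set i' := Ordinal lt_i.
    have -> : [seq tval (vec i' (S a i')) | a <- enum 'I_(dim_n I)] =
        [seq tval (vec i' j) | j <- [seq S a i' | a <- enum 'I_(dim_n I)]].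
      by rewrite -map_comp.
    apply: perm_map; have inj_S : injective (fun a => S a i').
      move=> a b Eab; apply/eqP/contraT => /eqP ne_ab.
      by case: (solS _ _ ne_ab i').
    rewrite -/(image _ _) -/(codom _); apply: uniq_perm; rewrite ?enum_uniq //.
      by rewrite map_inj_uniq ?enum_uniq.
    move=> b; rewrite mem_enum; apply/mapP; have [g _ gK] := injF_bij inj_S.
    by exists (g b); rewrite ?mem_enum ?gK.
  rewrite (@cost_solution _ S) // => i a; rewrite /W valK.
  by rewrite (nth_map a) ?size_enum_ord // nth_ord_enum.
have ex i : exists s : 'I_(dim_n I) -> 'I_(dim_n I), injective s /\
    forall a : 'I_(dim_n I), nth [::] (W (val i)) a = vec i (s a).
  have := perm_W i (ltn_ord i); rewrite nth_rows_of.
  move=> /(perm_iotaP [::])[Is]; rewrite size_map size_enum_ord => perm_Is ->.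
  have lt_Is (a : 'I_(dim_n I)) : nth 0 Is a < dim_n I.
    have : nth 0 Is a \in Is by rewrite mem_nth // (perm_size perm_Is) size_iota.
    by rewrite (perm_mem perm_Is) mem_iota.
  have sz_Is : size Is = dim_n I by rewrite (perm_size perm_Is) size_iota.
  exists (fun a => Ordinal (lt_Is a)); split=> [a b [/eqP]|a].
    rewrite nth_uniq ?sz_Is // ?(perm_uniq perm_Is) ?iota_uniq //.
    by move=> /eqP/val_inj.
  rewrite (nth_map 0) ?sz_Is // (nth_map a) ?size_enum_ord //.
  by congr (tval (vec _ _)); apply: val_inj; rewrite /= nth_enum_ord.
have [sigma sigmaP] := fin_all_exists ex.
exists (fun a => [ffun i => sigma i a]); split=> [a b ne_ab i|].
  by rewrite !ffunE => /(proj1 (sigmaP i)).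
rewrite -(@cost_solution _ _ W) // => i a; rewrite ffunE.
exact: (proj2 (sigmaP i)).
Qed.

(** * Properties of the flags and of the column conjunction *)

Lemma perm_drops p e (rows : seq (seq bool)) :
  all (fun v => size v == p) rows -> e <= count (all id) rows ->
  perm_eq rows (nseq e (ones p) ++ mask (map negb (drops (all id) e rows)) rows).
Proof.
elim: rows e => [|v rows IH] [|e] //=.
- by move=> /andP[_ szs] _; rewrite andbF sub0n perm_cons; exact: (IH 0).
move=> /andP[/eqP sz_v szs]; rewrite andbT all_id_ones sz_v.
case: eqP => [->|_] le_e /=.
  by rewrite subn1 perm_cons; apply: IH.
by rewrite subn0 perm_sym -[v :: mask _ _]cat1s -[_ :: nseq _ _ ++ _]/(nseq e.+1 _ ++ _)
  perm_catCA perm_cons perm_sym; apply: IH.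
Qed.

Lemma count_drops (T : Type) (P : pred T) e s : e <= count P s ->
  count negb (drops P e s) = size s - e.
Proof.
elim: s e => [|x s IH] [|e] //=.
- by move=> _; rewrite andbF add1n sub0n IH ?subn0.
rewrite andbT; case: (P x) => /=; rewrite ?subn1 ?subn0 /=.
  by rewrite add1n => /IH->; rewrite subSS.
by move=> le_e; rewrite IH //; have := count_size P s; lia.
Qed.

Lemma nth_drops (T : Type) (P : pred T) x0 e s r :
  nth false (drops P e s) r -> P (nth x0 s r).
Proof. by elim: s e r => [|x s IH] e [|r] //= => [/andP[]|/IH]. Qed.

Lemma nth_column_ands p (rows : seq (seq bool)) r :
  all (fun v => size v == p) rows -> r < p ->
  nth true (column_ands p rows) r = all (fun v => nth true v r) rows.
Proof.
move=> szs lt_r; rewrite /column_ands.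
have : size (ones p) = p by rewrite size_nseq.
(* The contribution of the initial accumulator [ones p] is made visible, so that the induction can
   generalize over it. *)
have -> : all (fun v => nth true v r) rows =
    nth true (ones p) r && all (fun v => nth true v r) rows.
  by rewrite nth_nseq lt_r.
elim: rows (ones p) szs => [|v rows IH] a /=; first by rewrite andbT.
move=> /andP[/eqP sz_v szs] sz_a; rewrite IH //; last first.
  by rewrite size_map size_zip sz_a sz_v minnn.
rewrite (nth_map (true, true)) ?size_zip ?sz_a ?sz_v ?minnn //.
by rewrite nth_zip ?sz_a //= (andbC (nth true v r)) andbA.
Qed.

Lemma mask_proj p x v : size x = p -> size v = p ->
  mask (map negb x) v = proj [seq r <- iota 0 p | ~~ nth false x r] v.
Proof.
move=> sz_x sz_v; rewrite /proj filter_mask -{1}(mkseq_nth true v) sz_v /mkseq.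
rewrite map_mask -{1}(mkseq_nth false x) sz_x /mkseq -map_comp.
by [].
Qed.

Lemma flatten_map_flatten (T : Type) (s : seq (seq (seq T))) :
  flatten (map flatten s) = flatten (flatten s).
Proof. by elim: s => //= v s ->; rewrite flatten_cat. Qed.

Lemma encode_rows (I : instance) :
  encode I = encode_nat (dim_m I) ++ encode_nat (dim_n I) ++
    encode_nat (dim_p I) ++ encode_nat (budget I) ++ flatten (flatten (rows_of I)).
Proof. by rewrite -flatten_map_flatten /rows_of -map_comp. Qed.

Lemma all_flatten (T : Type) (P : pred T) (V : seq (seq T)) :
  all P (flatten V) = all (fun i => all P (nth [::] V i)) (iota 0 (size V)).
Proof.
rewrite -(all_map (nth [::] V) (all P)) -/(mkseq _ _) mkseq_nth.
by elim: V => //= s V IH; rewrite all_cat IH.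
Qed.

Lemma assignable_ext m n p k V V' : (forall i, i < m -> V i = V' i) ->
  assignable m n p k V <-> assignable m n p k V'.
Proof.
by move=> E; split=> -[W [perm_W le_k]]; exists W; split=> // i lt_i;
  [rewrite -E | rewrite E] => //; apply: perm_W.
Qed.

Lemma assignable_trivial m n p k V : m * n * p = 0 -> assignable m n p k V.
Proof.
move=> mnp0; exists V; split=> //; rewrite /cost /stack_cost.
move: mnp0 => /eqP; rewrite !muln_eq0 => /orP[/orP[]|] /eqP->.
- by rewrite big1 // => a _; rewrite big1.
- by rewrite big_nil.
by rewrite big1 // => a _; rewrite big_nil.
Qed.

Definition trivial_yes := of_rows 0 0 0 0 [::].
Definition trivial_no := of_rows 1 1 1 0 [:: [:: [:: false]]].

Section Kernel.

Variable I : instance.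

Local Notation m := (dim_m I).
Local Notation n := (dim_n I).
Local Notation p := (dim_p I).
Local Notation k := (budget I).
Local Notation V := (rows_of I).
Local Notation a := (column_ands p (flatten V)).

Definition kernel_rows :=
  [seq reduce_rows (n - k) (drops id (p - k) a) rows | rows <- V].

(** With budget 0 and no deficit nothing remains to be paid, so the answer is yes; a constant
    instance is needed there because the size bound no longer leaves room for the digits of m. *)
Definition kernel : instance :=
  if flatten (flatten V) == [::] then trivial_yes
  else if 0 < deficit (n - k) (p - k) a V then trivial_no
  else if k == 0 then trivial_yes
  else of_rows m (minn n k) (minn p k) k kernel_rows.

Lemma all_size_rows : all (fun rows => size rows == n) V.
Proof.
by apply/(all_nthP [::]) => i; rewrite size_rows_of => /wf_rows_of[->].
Qed.

Lemma all_size_vectors : all (fun v => size v == p) (flatten V).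
Proof.
rewrite all_flatten size_rows_of; apply/allP => i.
by rewrite mem_iota => /andP[_ /wf_rows_of[_]].
Qed.

Lemma size_columns : size a = p.
Proof. by apply: size_foldl_vand; rewrite ?size_nseq ?all_size_vectors. Qed.

Lemma count_columns : count id a =
  count (fun r => all (fun i => all (fun v => nth true v r) (nth [::] V i)) (iota 0 m))
        (iota 0 p).
Proof.
rewrite -{1}(mkseq_nth true a) size_columns /mkseq count_map.
apply: eq_in_count => r; rewrite mem_iota => /andP[_ lt_r] /=.
by rewrite nth_column_ands ?all_size_vectors // all_flatten size_rows_of.
Qed.

Lemma deficit_gt0 : 0 < deficit (n - k) (p - k) a V -> ~ bMVA I.
Proof.
move=> def_gt0 /bMVA_assignable asg; move: def_gt0; rewrite lt0n => /eqP[].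
rewrite /deficit count_columns.
apply/eqP; rewrite addn_eq0 subn_eq0 (assignable_nonconstant (@wf_rows_of I) asg) /=.
rewrite sum_nat_seq_eq0; apply/(all_nthP [::]) => i; rewrite size_rows_of => lt_i /=.
by rewrite subn_eq0 (assignable_ones (@wf_rows_of I) asg).
Qed.

Hypothesis no_deficit : deficit (n - k) (p - k) a V = 0.

Lemma enough_rows i : i < m -> n - k <= count (all id) (nth [::] V i).
Proof.
move=> lt_i; move/eqP: no_deficit; rewrite addn_eq0 sum_nat_seq_eq0 => /andP[_].
by move=> /(all_nthP [::])/(_ i); rewrite size_rows_of => /(_ lt_i) /=; rewrite subn_eq0.
Qed.

Lemma enough_columns : p - k <= count id a.
Proof. by move/eqP: no_deficit; rewrite addn_eq0 subn_eq0 => /andP[]. Qed.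

Local Notation x := (drops id (p - k) a).
Local Notation idx := [seq r <- iota 0 p | ~~ nth false x r].
Definition kept_rows i :=
  mask (map negb (drops (all id) (n - k) (nth [::] V i))) (nth [::] V i).

Lemma size_flags : size x = p.
Proof. by rewrite size_drops size_columns. Qed.

Lemma size_idx : size idx = minn p k.
Proof.
rewrite size_filter (_ : minn p k = count negb x).
  rewrite -[in RHS](mkseq_nth false x) size_flags /mkseq count_map.
  exact: eq_count.
by rewrite (count_drops enough_columns) size_columns; lia.
Qed.

Lemma wf_kept_rows : wf m (minn n k) p kept_rows.
Proof.
move=> i lt_i; have [sz_i szs_i] := wf_rows_of lt_i; split.
  rewrite size_mask ?size_map ?size_drops // count_map.
  by rewrite (eq_count (a2 := negb)) // count_drops ?enough_rows // sz_i; lia.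
by apply/allP => v /mem_mask; apply: (allP szs_i).
Qed.

Lemma nth_kernel_rows i : i < m -> nth [::] kernel_rows i = map (proj idx) (kept_rows i).
Proof.
move=> lt_i; rewrite (nth_map [::]) ?size_rows_of //.
apply/eq_in_map => v v_i; apply: mask_proj; first exact: size_flags.
by have [_ /allP/(_ v v_i)/eqP] := wf_kept_rows lt_i.
Qed.

Lemma wf_kernel_rows : wf m (minn n k) (minn p k) (nth [::] kernel_rows).
Proof.
move=> i lt_i; rewrite nth_kernel_rows // size_map.
have [-> _] := wf_kept_rows lt_i; split=> //.
by rewrite all_map; apply/allP => v _ /=; rewrite size_map size_idx.
Qed.

Lemma kernel_rows_correct :
  bMVA I <-> assignable m (minn n k) (minn p k) k (nth [::] kernel_rows).
Proof.
have n_e : n - (n - k) = minn n k by lia.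
rewrite bMVA_assignable.
rewrite (@assignable_rows _ _ _ _ (n - k) _ kept_rows (@wf_rows_of I)) ?leq_subr //.
  rewrite n_e (@assignable_columns _ _ _ _ idx _ wf_kept_rows).
  - by rewrite size_idx; apply: assignable_ext => i /nth_kernel_rows.
  - by rewrite filter_uniq ?iota_uniq.
  - by apply/allP => r; rewrite mem_filter mem_iota => /andP[_ /andP[]].
  move=> i v r lt_i /mem_mask v_i lt_r.
  (* A flagged coordinate has conjunction 1 over all the original vectors, in particular over the
     kept ones. *)
  rewrite mem_filter mem_iota add0n lt_r /= andbT negbK => /(@nth_drops _ _ true) /=.
  rewrite nth_column_ands ?all_size_vectors // all_flatten size_rows_of => /allP/(_ i).
  by rewrite mem_iota lt_i => /(_ isT)/allP/(_ v v_i).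
move=> i lt_i; apply: perm_drops; last exact: enough_rows.
by have [] := wf_rows_of lt_i.
Qed.

End Kernel.

(** * Code, size and running time of the kernel *)

Lemma encode_of_rows m n p k V : size V = m -> wf m n p (nth [::] V) ->
  encode (of_rows m n p k V) = encode_nat m ++ encode_nat n ++ encode_nat p ++
    encode_nat k ++ flatten (flatten V).
Proof. by move=> sz_V wfV; rewrite encode_rows rows_ofK. Qed.

Lemma wf_trivial_no : wf 1 1 1 (nth [::] [:: [:: [:: false]]]).
Proof. by case. Qed.

Lemma encode_trivial_yes : encode trivial_yes = yes_word.
Proof. by rewrite encode_of_rows. Qed.

Lemma encode_trivial_no : encode trivial_no = no_word.
Proof. by rewrite encode_of_rows //; exact: wf_trivial_no. Qed.

Lemma bMVA_of_rows m n p k V : size V = m -> wf m n p (nth [::] V) ->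
  bMVA (of_rows m n p k V) <-> assignable m n p k (nth [::] V).
Proof. by move=> sz_V wfV; rewrite bMVA_assignable rows_ofK. Qed.

Lemma trivial_yes_yes : bMVA trivial_yes.
Proof. by apply/bMVA_of_rows => //; exact: assignable_trivial. Qed.

Lemma trivial_no_no : ~ bMVA trivial_no.
Proof.
move=> /(@bMVA_of_rows 1 1 1 0 [:: [:: [:: false]]] erefl wf_trivial_no) asg.
by have := assignable_ones wf_trivial_no asg (isT : 0 < 1).
Qed.

Lemma size_data (I : instance) :
  size (flatten (flatten (rows_of I))) = dim_m I * dim_n I * dim_p I.
Proof.
rewrite -flatten_map_flatten size_flatten /shape sumnE 3!big_map.
rewrite (eq_bigr (fun=> dim_n I * dim_p I)) => [|i _].
  by rewrite big_const_seq count_predT iter_addn_0 size_enum_ord mulnC mulnA.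
rewrite size_flatten /shape sumnE 2!big_map (eq_bigr (fun=> dim_p I)) => [|j _].
  by rewrite big_const_seq count_predT iter_addn_0 size_enum_ord mulnC.
by rewrite size_tuple.
Qed.

Lemma kernel_correct (I : instance) : bMVA (kernel I) <-> bMVA I.
Proof.
rewrite /kernel; case: eqP => [d0|_].
  split=> _; last exact: trivial_yes_yes.
  by apply/bMVA_assignable/assignable_trivial; rewrite -size_data d0.
case: posnP => [def0|def_gt0]; last first.
  by split=> [/trivial_no_no|/deficit_gt0]; last exact.
rewrite (kernel_rows_correct def0); case: eqP => [k0|_].
  split=> _; last exact: trivial_yes_yes.
  by apply: assignable_trivial; rewrite k0 !minn0 !muln0.
by apply: bMVA_of_rows; [rewrite size_map size_rows_of | exact: wf_kernel_rows].
Qed.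

Lemma size_binary x : size (binary x) <= x.
Proof. by rewrite size_mkseq up_log_min // ltn_expl. Qed.

Lemma size_kernel (I : instance) :
  size (encode (kernel I)) <= 11 * (budget I ^ 2 * dim_m I + 1).
Proof.
rewrite /kernel; case: eqP => [_|/eqP d_ne].
  by rewrite encode_trivial_yes /=; lia.
case: posnP => [def0|_]; last first.
  (* The constant 11 is the length of [no_word]. *)
  by rewrite encode_trivial_no mulnDr leq_addl.
case: posnP => [_|k_gt0].
  by rewrite encode_trivial_yes /=; lia.
(* With m and k positive, both are at most [k ^ 2 * m], so even the crude bound [size_binary]
   suffices for the header. *)
have m_gt0 : 0 < dim_m I.
  by move: d_ne; rewrite -size_eq0 size_data -lt0n !muln_gt0 => /andP[/andP[]].
rewrite encode_rows; do 4 rewrite size_cat size_encode_nat.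
rewrite size_data /=; move: (size_binary (dim_m I)) (size_binary (budget I)).
move: (size_binary (minn (dim_n I) (budget I))).
move: (size_binary (minn (dim_p I) (budget I))).
have le_n := geq_minr (dim_n I) (budget I).
have le_p := geq_minr (dim_p I) (budget I).
have : dim_m I * minn (dim_n I) (budget I) * minn (dim_p I) (budget I)
    <= budget I ^ 2 * dim_m I.
  by rewrite -mulnA [leqRHS]mulnC leq_mul // expnS expn1 leq_mul.
have : dim_m I <= budget I ^ 2 * dim_m I by rewrite leq_pmull ?expn_gt0 ?k_gt0.
have : budget I <= budget I ^ 2 * dim_m I.
  by rewrite expnS expn1 -mulnA leq_pmulr // muln_gt0 k_gt0.
lia.
Qed.

Lemma kernel_polynomial : polynomial_time kernel.
Proof.
exists (machine 24 program), 1000, 2 => I.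
have Ew := encode_rows I; have sz_d := size_data I.
case d_nil: (flatten (flatten (rows_of I)) == [::]).
  rewrite (eqP d_nil) in Ew.
  have [//|//|//|s [R E]] := @run_program _ _ _ _ [::] _ Ew.
  by rewrite /kernel d_nil encode_trivial_yes -[yes_word]E; exact: runs_outputs.
have mnp_gt0 : 0 < dim_m I * dim_n I * dim_p I.
  by rewrite -sz_d lt0n size_eq0 d_nil.
have /andP[/andP[m_gt0 n_gt0] p_gt0] : (0 < dim_m I) && (0 < dim_n I) && (0 < dim_p I).
  by rewrite -!muln_gt0.
have cap_n : minn (size (flatten (flatten (rows_of I)))) (dim_n I) = dim_n I.
  by apply/minn_idPr; rewrite sz_d mulnAC leq_pmull // muln_gt0 m_gt0.
have cap_p : minn (size (flatten (flatten (rows_of I)))) (dim_p I) = dim_p I.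
  by apply/minn_idPr; rewrite sz_d leq_pmull // muln_gt0 m_gt0.
have := @run_program _ _ _ _ (rows_of I) _ Ew; rewrite /= cap_n cap_p.
(* Since n is at most the length of the data, capping k at that length leaves the truncated
   difference unchanged; the same holds for p. *)
have -> : dim_n I - minn (size (flatten (flatten (rows_of I)))) (budget I) =
  dim_n I - budget I by lia.
have -> : dim_p I - minn (size (flatten (flatten (rows_of I)))) (budget I) =
  dim_p I - budget I by lia.
rewrite all_size_rows all_size_vectors d_nil => -[||//|s [R E]] //.
  apply/(all_nthP [::]) => i; rewrite size_rows_of => lt_i.
  have [sz_i szs_i] := wf_rows_of lt_i; apply/eqP => flat0.
  have := congr1 size flat0; rewrite size_flatten /shape sumnE big_map.
  rewrite (eq_big_seq (fun=> dim_p I)) => [|v /(allP szs_i)/eqP//].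
  by rewrite big_const_seq count_predT iter_addn_0 sz_i => /eqP;
     rewrite muln_eq0 !eqn0Ngt n_gt0 p_gt0.
have -> : encode (kernel I) = s 0; last exact: runs_outputs.
rewrite E /kernel d_nil; case: posnP => [def0|_]; last exact: encode_trivial_no.
case: eqP => [_|_]; first exact: encode_trivial_yes.
rewrite encode_of_rows; last exact: wf_kernel_rows.
  rewrite /kernel_rows; congr (_ ++ (encode_nat _ ++ (encode_nat _ ++ _))).
    by case: eqP; lia.
  by case: eqP; lia.
by rewrite size_map size_rows_of.
Qed.

Theorem theorem1 :
  exists kernel : instance -> instance,
    polynomial_time kernel /\
    (forall I : instance, bMVA (kernel I) <-> bMVA I) /\
    (exists C : nat, forall I : instance,
       size (encode (kernel I)) <= C * (budget I ^ 2 * dim_m I + 1)).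
Proof.
exists kernel; split; first exact: kernel_polynomial.
split; first exact: kernel_correct.
by exists 11; exact: size_kernel.
Qed.
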